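(* Let $\mathcal U,\mathcal Y_1,\mathcal Y$ be separable Hilbert spaces, and let $\Sigma_1=(A_1,B_1,C_1,D_1;\mathcal X_1,\mathcal U,\mathcal Y_1;\kappa_1)$ and $\Sigma_2=(A_2,B_2,C_2,D_2;\mathcal X_2,\mathcal Y_1,\mathcal Y;\kappa_2)$ be co-isometric and observable realizations of the functions $S_1\in\mathbf S_{\kappa_1}(\mathcal U,\mathcal Y_1)$ and $S_2\in\mathbf S_{\kappa_2}(\mathcal Y_1,\mathcal Y)$, respectively. Then the product $\Sigma=\Sigma_2\circ\Sigma_1$ is a co-isometric observable realization of $S=S_2S_1$ if and only if the following two conditions hold: (i) $\mathcal H(S)=S_2\mathcal H(S_1)\oplus\mathcal H(S_2)$; (ii) the mapping $h_1\mapsto S_2h_1$ is an isometry from $\mathcal H(S_1)$ to $S_2\mathcal H(S_1)$.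
   Context: All spaces are complex and separable. A Pontryagin space $\mathcal X$ is a vector space with a Hermitian indefinite inner product admitting an orthogonal decomposition $\mathcal X=\mathcal X^+\oplus\mathcal X^-$, where $(\mathcal X^{\pm},\pm\langle\cdot,\cdot\rangle)$ are Hilbert spaces and $\dim\mathcal X^-<\infty$; its negative index is $\dim \mathcal X^-$. Topological notions refer to the Hilbert space topology of $\mathcal X^+\oplus(-\mathcal X^-)$; adjoints and orthogonality are with respect to the indefinite inner products. $\oplus$ denotes orthogonal direct sum. $\mathcal L(\cdot,\cdot)$ denotes continuous linear operators. Generalized Schur class: $\mathbf S_\kappa(\mathcal U,\mathcal Y)$ is the set of $\mathcal L(\mathcal U,\mathcal Y)$-valued functions $S$ meromorphic in the unit disc $\mathbb D$ and holomorphic near $0$ such that the kernel $K_S(w,z)=\frac{1-S(z)S(w)^*}{1-z\bar w}$ has $\kappa$ negative squares, i.e. every Hermitian matrix $(\langle K_S(w_j,w_i)f_j,f_i\rangle)_{i,j=1}^n$ with $w_i$ in the domain of holomorphy $\rho(S)$ and $f_i\in\mathcal Y$ has at most $\kappa$ negative eigenvalues, and some such matrix has exactly $\kappa$. A product $S=S_2S_1$ of generalized Schur functions is a generalized Schur function. $\mathcal H(S)$ is the reproducing kernel Pontryagin space (of negative index equal to the number of negative squares) of $\mathcal Y$-valued functions on $\rho(S)$ with kernel $K_S$: it contains all $K_S(w,\cdot)f$ and $\langle h,K_S(w,\cdot)f\rangle_{\mathcal H(S)}=\langle h(w),f\rangle_{\mathcal Y}$. Functions are identified when they agree near $0$. $S_2\mathcal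 H(S_1)=\{S_2h_1:h_1\in\mathcal H(S_1)\}$; in (i) and (ii) it is regarded as a subspace of $\mathcal H(S)$ with the inner product of $\mathcal H(S)$. System: $\Sigma=(A,B,C,D;\mathcal X,\mathcal U,\mathcal Y;\kappa)$ consists of a Pontryagin space $\mathcal X$ of negative index $\kappa$, Hilbert spaces $\mathcal U,\mathcal Y$, and a system operator $T_\Sigma=\begin{pmatrix}A&B\\ C&D\end{pmatrix}\in\mathcal L(\mathcal X\oplus\mathcal U,\mathcal X\oplus\mathcal Y)$. It is co-isometric if $T_\Sigma T_\Sigma^*=I$, and observable if $\overline{\mathrm{span}}\{\mathrm{ran}\,A^{*n}C^*:n\ge0\}=\mathcal X$. Its transfer function is $\theta_\Sigma(z)=D+zC(I-zA)^{-1}B$; $\Sigma$ is a realization of $\theta$ if $\theta_\Sigma=\theta$ near $0$. Product: $\Sigma_2\circ\Sigma_1$ is the system with state space $\mathcal X_1\oplus\mathcal X_2$, incoming space $\mathcal U$, outgoing space $\mathcal Y$, negative index $\kappa_1+\kappa_2$, main operator $\begin{pmatrix}A_1&0\\ B_2C_1&A_2\end{pmatrix}$, control operator $\begin{pmatrix}B_1\\ B_2D_1\end{pmatrix}$, observation operator $\begin{pmatrix}D_2C_1&C_2\end{pmatrix}$ and feedthrough operator $D_2D_1$. *)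

(* Defs.v *)
From HB Require Import structures.
From mathcomp Require Import all_boot all_order all_algebra.
From mathcomp Require Import all_classical all_reals all_analysis.
From mathcomp Require Export complex.

Set Implicit Arguments.
Unset Strict Implicit.
Unset Printing Implicit Defensive.

Import Order.TTheory GRing.Theory Num.Theory.
Import numFieldNormedType.Exports.

Local Open Scope classical_set_scope.
Local Open Scope ring_scope.

Definition separable (T : topologicalType) : Prop :=
  exists D : set T, countable D /\ dense D.

Section Subspaces.
Context {K : numClosedFieldType} {V : lmodType K}.
Implicit Types (form : V -> V -> K) (M N : set V).

Definition subspace M : Prop := submod_closed [in M].

Lemma subspaceP M :
  subspace M <-> M 0 /\ forall a x y, M x -> M y -> M (a *: x + y).
Proof.
split=> [[M0 Ml]|[M0 Ml]].
  split=> [|a x y Mx My]; first by move: M0; rewrite inE.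
  by have := Ml a x y; rewrite !inE; apply.
by split=> [|a x y]; rewrite !inE //; exact: Ml.
Qed.

Definition has_dim (k : nat) M : Prop :=
  exists e : 'I_k -> V,
    (forall x, M x <-> exists a : 'I_k -> K, x = \sum_i a i *: e i) /\
    (forall a : 'I_k -> K, \sum_i a i *: e i = 0 -> forall i, a i = 0).

Definition orthogonal_sum form M N : Prop :=
  [/\ subspace M, subspace N,
      forall x, exists m n, [/\ M m, N n & x = m + n],
      forall x, M x -> N x -> x = 0 &
      forall m n, M m -> N n -> form m n = 0].

Definition lin_span M : set V :=
  [set x | exists n (a : 'I_n -> K) (g : 'I_n -> V),
     (forall i, M (g i)) /\ x = \sum_i a i *: g i].

End Subspaces.

(* The norm of V is a complete norm, so it gives V the topology of the Hilbert
   space V+ (+) (-V-) exactly when it is equivalent to the norm of that space;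
   then V+ and -V- are themselves complete. The norm itself is not required to
   be the one of V+ (+) (-V-), so that products keep the maximum norm. *)
Definition fundamental_decomposition {K : numClosedFieldType}
    {V : normedModType K} (form : V -> V -> K) (k : nat) (Vp Vm : set V) : Prop :=
  [/\ orthogonal_sum form Vp Vm,
      (forall x, Vp x -> x != 0 -> 0 < form x x),
      (forall x, Vm x -> x != 0 -> form x x < 0),
      has_dim k Vm &
      exists c d : K, [/\ 0 < c, 0 < d &
        forall xp xm, Vp xp -> Vm xm ->
          c * `|xp + xm| ^+ 2 <= form xp xp - form xm xm <= d * `|xp + xm| ^+ 2]].

HB.mixin Record isPontryagin (K : numClosedFieldType) V
    & CompleteNormedModule K V := {
  ip : {hermitian V for false & Num.conj_op} ;
  pontryagin_separable : separable V ;
  pontryagin_subproof :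
    exists k (Vp Vm : set V), fundamental_decomposition ip k Vp Vm
}.

#[short(type="pontryaginType")]
HB.structure Definition Pontryagin (K : numClosedFieldType) :=
  {V of isPontryagin K V & CompleteNormedModule K V}.

HB.mixin Record isHilbert (K : numClosedFieldType) V & Pontryagin K V := {
  normr_ip : forall x : V, `|x| ^+ 2 = (ip : V -> V -> K) x x
}.

#[short(type="hilbertType")]
HB.structure Definition Hilbert (K : numClosedFieldType) :=
  {V of isHilbert K V & Pontryagin K V}.

Notation "''[' x , y ]" := (ip x y) : ring_scope.



HB.saturate prod.

Section ProductComplete.
Context {K : numClosedFieldType} {V W : completeNormedModType K}.

Lemma prod_cauchy_cvg (F : set_system (V * W)%type) :
  ProperFilter F -> cauchy F -> cvg F.
Proof.
move=> FF /cauchyP Fc.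
have c1 : cvg (fst @ F).
  apply: cauchy_cvg; apply/cauchyP => e e0.
  have [[x y] Fxy] := Fc e e0; exists x.
  by rewrite /= /nbhs /=; apply: filterS Fxy => -[a b] [].
have c2 : cvg (snd @ F).
  apply: cauchy_cvg; apply/cauchyP => e e0.
  have [[x y] Fxy] := Fc e e0; exists y.
  by rewrite /= /nbhs /=; apply: filterS Fxy => -[a b] [].
apply/cvg_ex; exists (lim (fst @ F), lim (snd @ F)).
have := cvg_pair c1 c2.
have -> : (fun x : V * W => (x.1, x.2)) = id by apply/funext => -[].
exact.
Qed.

HB.instance Definition _ := Uniform_isComplete.Build (V * W)%type prod_cauchy_cvg.

End ProductComplete.

Section ProductPontryagin.
Context {K : numClosedFieldType} {V W : pontryaginType K}.

Definition prod_ip (p q : V * W) : K := '[p.1, q.1] + '[p.2, q.2].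

Lemma prod_ip_bilinear : bilinear_for *%R (Num.conj_op \; *%R) prod_ip.
Proof.
split=> [q a x y|p a x y]; rewrite /prod_ip /=.
  by rewrite !linearPl /= mulrDr addrACA.
by rewrite !linearPr /= mulrDr addrACA.
Qed.

HB.instance Definition _ :=
  bilinear_isBilinear.Build K _ _ K _ _ prod_ip prod_ip_bilinear.

Lemma prod_ip_hermitian x y :
  prod_ip x y = (-1) ^+ false * Num.conj_op (prod_ip y x).
Proof.
by rewrite expr0 mul1r /prod_ip rmorphD /= (hermC _ x.1) (hermC _ x.2)
  expr0 !mul1r.
Qed.

HB.instance Definition _ :=
  isHermitianSesquilinear.Build K _ false Num.conj_op prod_ip prod_ip_hermitian.

Lemma prod_separable : separable (V * W)%type.
Proof.
have [D [cD dD]] := @pontryagin_separable K V.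
have [E [cE dE]] := @pontryagin_separable K W.
exists (D `*` E); split; first exact: countableX.
move=> O [[x y] Oxy] oO.
have [[A B] [/= nA nB] AB] : nbhs (x, y) O by exact: open_nbhs_nbhs.
move: nA; rewrite nbhsE => -[A' [oA A'x] A'A].
move: nB; rewrite nbhsE => -[B' [oB B'y] B'B].
have [a [A'a Da]] := dD A' (ex_intro _ x A'x) oA.
have [b [B'b Eb]] := dE B' (ex_intro _ y B'y) oB.
by exists (a, b); split => //; apply: AB; split => /=; [exact: A'A|exact: B'B].
Qed.

Lemma prod_fundamental_decomposition j k (Vp Vm : set V) (Wp Wm : set W) :
  fundamental_decomposition ip j Vp Vm -> fundamental_decomposition ip k Wp Wm ->
  fundamental_decomposition prod_ip (j + k) (Vp `*` Wp) (Vm `*` Wm).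
Proof.
move=> [[sVp sVm VS VI VO] Vpos Vneg [e [eS eF]] [c [d [c0 d0 Vcd]]]].
move=> [[sWp sWm WS WI WO] Wpos Wneg [f [fS fF]] [c' [d' [c'0 d'0 Wcd]]]].
have [Vp0 Vpl] := (subspaceP _).1 sVp; have [Vm0 Vml] := (subspaceP _).1 sVm.
have [Wp0 Wpl] := (subspaceP _).1 sWp; have [Wm0 Wml] := (subspaceP _).1 sWm.
split.
- split.
  + by apply/subspaceP; split=> // a [x1 x2] [y1 y2] [? ?] [? ?]; split;
      [exact: Vpl|exact: Wpl].
  + by apply/subspaceP; split=> // a [x1 x2] [y1 y2] [? ?] [? ?]; split;
      [exact: Vml|exact: Wml].
  + move=> [x y]; have [m [n [? ? ->]]] := VS x; have [m' [n' [? ? ->]]] := WS y.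
    by exists (m, m'), (n, n').
  + by move=> [x y] [/= ? ?] [/= ? ?]; rewrite (VI x)// (WI y).
  + move=> [x y] [x' y'] [/= ? ?] [/= ? ?].
    by rewrite /prod_ip /= VO// WO// addr0.
- move=> [x y] [/= Vx Wy] xy0; rewrite /prod_ip /=.
  have [x0|x0] := eqVneq x 0; last first.
    apply: ltr_wpDr; last exact: Vpos.
    by have [->|/(Wpos _ Wy)/ltW//] := eqVneq y 0; rewrite linear0l.
  rewrite x0 linear0l add0r; apply: Wpos => //.
  by apply: contraNneq xy0 => ->; rewrite x0.
- move=> [x y] [/= Vx Wy] xy0; rewrite /prod_ip /=.
  have [x0|x0] := eqVneq x 0; last first.
    rewrite -(addr0 0); apply: ltr_leD; first exact: Vneg.
    by have [->|/(Wneg _ Wy)/ltW//] := eqVneq y 0; rewrite linear0l.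
  rewrite x0 linear0l add0r; apply: Wneg => //.
  by apply: contraNneq xy0 => ->; rewrite x0.
- pose g (i : 'I_(j + k)) : V * W :=
    match fintype.split i with inl a => (e a, 0) | inr b => (0, f b) end.
  have gE (a : 'I_(j + k) -> K) : \sum_i a i *: g i =
      (\sum_i a (lshift k i) *: e i, \sum_i a (rshift j i) *: f i).
    rewrite big_split_ord /=.
    under eq_bigr => i _ do rewrite /g -[lshift k i]/(unsplit (inl i)) unsplitK.
    under [X in _ + X]eq_bigr => i _ do
      rewrite /g -[rshift j i]/(unsplit (inr i)) unsplitK.
    apply/eqP; rewrite -pair_eqE /=; apply/andP.
    split; apply/eqP.
      rewrite (raddf_sum (@fst V W)) /= (raddf_sum (@fst V W)) /=.
      by rewrite [X in _ + X]big1 ?addr0// => i _; rewrite scaler0.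
    rewrite (raddf_sum (@snd V W)) /= (raddf_sum (@snd V W)) /=.
    by rewrite [X in X + _]big1 ?add0r// => i _; rewrite scaler0.
  exists g; split=> [[x y]|a].
    split=> [[/= /eS[a ->] /fS[b ->]]|[a]].
      exists (fun i => match fintype.split i with inl u => a u | inr v => b v end).
      rewrite gE; congr (_, _); apply: eq_bigr => i _.
        by rewrite -[lshift k i]/(unsplit (inl i)) unsplitK.
      by rewrite -[rshift j i]/(unsplit (inr i)) unsplitK.
    rewrite gE => -[-> ->]; split => /=.
      by apply/eS; exists (a \o @lshift j k).
    by apply/fS; exists (a \o @rshift j k).
  rewrite gE => -[/eF ea /fF fa] i; rewrite -(splitK i).
  by case: (fintype.split i) => u /=; [exact: ea|exact: fa].
- exists (if c <= c' then c else c'), (d + d'); split.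
  + by case: ifP.
  + exact: addr_gt0.
  + move=> [x y] [x' y'] [/= Vx Wy] [/= Vx' Wy']; rewrite prod_normE /prod_ip /=.
    have /andP[V1 V2] := Vcd _ _ Vx Vx'; have /andP[W1 W2] := Wcd _ _ Wy Wy'.
    set A := '[x, x] - '[x', x'] in V1 V2 *.
    set B := '[y, y] - '[y', y'] in W1 W2 *.
    have -> : '[x, x] + '[y, y] - ('[x', x'] + '[y', y']) = A + B.
      by rewrite opprD addrACA.
    set u := `|x + x'| in V1 V2 *; set v := `|y + y'| in W1 W2 *.
    have u0 : 0 <= u by exact: normr_ge0.
    have v0 : 0 <= v by exact: normr_ge0.
    have cc : (if c <= c' then c else c') <= c /\ (if c <= c' then c else c') <= c'.
      have := real_leVge (gtr0_real c0) (gtr0_real c'0).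
      by case: ifP => //= _ ->.
    have cp : 0 < (if c <= c' then c else c') by case: ifP.
    move: cp cc; set m := (if _ then _ else _) => m0 [mc mc'].
    have A0 : 0 <= A by apply: le_trans V1; rewrite mulr_ge0 ?exprn_ge0// ltW.
    have B0 : 0 <= B by apply: le_trans W1; rewrite mulr_ge0 ?exprn_ge0// ltW.
    have uvc : u >=< v by exact: real_comparable (ger0_real u0) (ger0_real v0).
    have : u <= v \/ v <= u.
      by apply/orP; exact: (real_leVge (ger0_real u0) (ger0_real v0)).
    case=> uv.
      rewrite comparable_maxEgt// (le_gtF uv) mulrDl; apply/andP; split.
        rewrite -[leLHS]add0r; apply: lerD => //; apply: le_trans W1.
        by rewrite ler_wpM2r// exprn_ge0.
      apply: lerD => //; apply: le_trans V2 _; rewrite ler_wpM2l ?(ltW d0)//.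
      by rewrite lerXn2r.
    rewrite comparable_maxEge// uv mulrDl; apply/andP; split.
      rewrite -[leLHS]addr0; apply: lerD => //; apply: le_trans V1.
      by rewrite ler_wpM2r// exprn_ge0.
    apply: lerD => //; apply: le_trans W2 _; rewrite ler_wpM2l ?(ltW d'0)//.
    by rewrite lerXn2r.
Qed.

Lemma prod_pontryagin : exists k (Zp Zm : set (V * W)),
  fundamental_decomposition prod_ip k Zp Zm.
Proof.
have [j [Vp [Vm dV]]] := @pontryagin_subproof K V.
have [k [Wp [Wm dW]]] := @pontryagin_subproof K W.
by exists (j + k)%N, (Vp `*` Wp), (Vm `*` Wm);
  exact: prod_fundamental_decomposition.
Qed.

HB.instance Definition _ :=
  isPontryagin.Build K (V * W)%type prod_separable prod_pontryagin.

End ProductPontryagin.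

Definition neg_index {K : numClosedFieldType} (V : pontryaginType K) (k : nat) : Prop :=
  exists Vp Vm : set V, fundamental_decomposition ip k Vp Vm.

Lemma neg_index_prod (K : numClosedFieldType) (V W : pontryaginType K) j k :
  neg_index V j -> neg_index W k -> neg_index (V * W)%type (j + k).
Proof.
move=> [Vp [Vm dV]] [Wp [Wm dW]]; exists (Vp `*` Wp), (Vm `*` Wm).
exact: prod_fundamental_decomposition.
Qed.

Section Operators.
Context {K : numClosedFieldType}.

Record cont_linear (X Y : normedModType K) := ContLinear {
  cl_fun :> X -> Y ;
  cl_linear : linear cl_fun ;
  cl_continuous : continuous cl_fun }.

HB.instance Definition _ (X Y : normedModType K) (T : cont_linear X Y) :=
  GRing.isLinear.Build K X Y *:%R (cl_fun T) (cl_linear T).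

(* The adjoint with respect to the (indefinite) inner products; it is
   determined by this property as ip is nondegenerate, and a value exists for
   every y by the Riesz theorem when T is linear and continuous. *)
Definition adj {X Y : pontryaginType K} (T : X -> Y) (y : Y) : X :=
  xget 0 [set x' | forall x, '[T x, y] = '[x, x']].

End Operators.

Notation "''L' ( X , Y )" := (cont_linear X Y)
  (at level 8, format "''L' ( X ,  Y )") : type_scope.

Section OperatorFunctions.
Context {K : numClosedFieldType} {U Y : hilbertType K}.
Implicit Types (S g : K -> 'L(U, Y)) (z w p : K).

(* complex differentiability with respect to the operator norm *)
Definition op_derivable S z : Prop :=
  exists L : 'L(U, Y), forall e : K, 0 < e ->
    \forall h \near 0^', forall u : U,
      `|h^-1 *: (S (h + z) u - S z u) - L u| <= e * `|u|.

Definition holomorphic_at S z : Prop := \forall w \near z, op_derivable S w.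

(* A meromorphic function in the unit disc is represented by a total function
   on K; its values at the poles and outside of the disc are irrelevant, and
   its removable singularities are removed. *)
Definition meromorphic_in_disc S : Prop :=
  forall p, `|p| < 1 ->
    (exists (m : nat) g, holomorphic_at g p /\
       \forall z \near p^', forall u, S z u = (z - p) ^- m *: g z u) /\
    (forall g, holomorphic_at g p -> (\forall z \near p^', S z =1 g z) ->
       S p =1 g p).

Definition holomorphy_domain S : set K :=
  [set z | `|z| < 1 /\ holomorphic_at S z].

Definition schur_kernel S w z (f : Y) : Y :=
  (1 - z * w^*)^-1 *: (f - S z (adj (S w) f)).

Definition kernel_gram S n (w : 'I_n -> K) (f : 'I_n -> Y) : 'M[K]_n :=
  \matrix_(i, j) '[schur_kernel S (w j) (w i) (f j), f i].

Definition nb_neg_eigenvalues n (A : 'M[K]_n) : nat :=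
  #|[set i | spectral_diag A 0 i < 0]%SET|.

Definition negative_squares S (k : nat) : Prop :=
  (forall n (w : 'I_n -> K) (f : 'I_n -> Y),
     (forall i, holomorphy_domain S (w i)) ->
     (nb_neg_eigenvalues (kernel_gram S w f) <= k)%N) /\
  (exists n (w : 'I_n -> K) (f : 'I_n -> Y),
     (forall i, holomorphy_domain S (w i)) /\
     nb_neg_eigenvalues (kernel_gram S w f) = k).

Definition schur_class (k : nat) S : Prop :=
  [/\ meromorphic_in_disc S, holomorphic_at S 0 & negative_squares S k].

Definition eq_near0 (T : Type) (f g : K -> T) : Prop :=
  \forall z \near (0 : K), f z = g z.

(* The reproducing kernel Pontryagin space H(S): the vector h stands for the
   function rk_eval h on holomorphy_domain S. Functions are identified when
   they agree near 0, so such functions come from the same vector. *)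
Record rk_space S := RKSpace {
  rk_carrier :> pontryaginType K ;
  rk_eval : rk_carrier -> K -> Y ;
  rk_linear : forall z, holomorphy_domain S z -> linear (rk_eval ^~ z) ;
  rk_inj : forall h h', eq_near0 (rk_eval h) (rk_eval h') -> h = h' ;
  rk_kernel : forall w f, holomorphy_domain S w ->
    exists k : rk_carrier,
      (forall z, holomorphy_domain S z -> rk_eval k z = schur_kernel S w z f) /\
      (forall h, '[h, k] = '[rk_eval h w, f]) ;
  rk_index : exists k, negative_squares S k /\ neg_index rk_carrier k }.

End OperatorFunctions.

Record system (K : numClosedFieldType) (U Y : hilbertType K) (k : nat) := System {
  state : pontryaginType K ;
  state_index : neg_index state k ;
  main_op : 'L(state, state) ;
  control_op : 'L(U, state) ;
  observation_op : 'L(state, Y) ;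
  feedthrough_op : 'L(U, Y) }.

Section Systems.
Context {K : numClosedFieldType} {U Y : hilbertType K} {k : nat}.
Implicit Types Sigma : system U Y k.

Definition system_operator Sigma (p : state Sigma * U) : state Sigma * Y :=
  (main_op Sigma p.1 + control_op Sigma p.2,
   observation_op Sigma p.1 + feedthrough_op Sigma p.2).

Definition coisometric Sigma : Prop :=
  forall q, system_operator (adj (system_operator (Sigma := Sigma)) q) = q.

Definition observable Sigma : Prop :=
  closure (lin_span [set x : state Sigma |
    exists n y, x = iter n (adj (main_op Sigma)) (adj (observation_op Sigma) y)])
  = setT.

(* (I - z A)^-1; for z near 0 the equation has exactly one solution *)
Definition resolvent Sigma (z : K) (x : state Sigma) : state Sigma :=
  xget 0 [set x' | x' - z *: main_op Sigma x' = x].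

Definition transfer_function Sigma (z : K) (u : U) : Y :=
  feedthrough_op Sigma u +
  z *: observation_op Sigma (resolvent z (control_op Sigma u)).

Definition realizes Sigma (S : K -> 'L(U, Y)) : Prop :=
  eq_near0 (transfer_function Sigma) (fun z => S z : U -> Y).

End Systems.

Section ProductSystem.
Context {K : numClosedFieldType} {U Y1 Y : hilbertType K} {k1 k2 : nat}.
Variables (Sigma2 : system Y1 Y k2) (Sigma1 : system U Y1 k1).
Local Notation A1 := (main_op Sigma1).
Local Notation B1 := (control_op Sigma1).
Local Notation C1 := (observation_op Sigma1).
Local Notation D1 := (feedthrough_op Sigma1).
Local Notation A2 := (main_op Sigma2).
Local Notation B2 := (control_op Sigma2).
Local Notation C2 := (observation_op Sigma2).
Local Notation D2 := (feedthrough_op Sigma2).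
Local Notation X := (state Sigma1 * state Sigma2)%type.

Definition prod_main (x : X) : X := (A1 x.1, B2 (C1 x.1) + A2 x.2).
Definition prod_control (u : U) : X := (B1 u, B2 (D1 u)).
Definition prod_observation (x : X) : Y := D2 (C1 x.1) + C2 x.2.
Definition prod_feedthrough (u : U) : Y := D2 (D1 u).

Local Lemma comp_continuous (E F G : topologicalType) (f : E -> F) (g : F -> G) :
  continuous f -> continuous g -> continuous (fun x => g (f x)).
Proof. by move=> cf cg x; apply: continuous_comp; [exact: cf|exact: cg]. Qed.

Local Lemma pair_continuous (E F G : topologicalType) (f : E -> F) (g : E -> G) :
  continuous f -> continuous g -> continuous (fun x => (f x, g x)).
Proof. by move=> cf cg x; apply: cvg_pair; [exact: cf|exact: cg]. Qed.

Local Lemma add_continuous (E : topologicalType) (F : normedModType K) (f g : E -> F) :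
  continuous f -> continuous g -> continuous (fun x => f x + g x).
Proof. by move=> cf cg x; apply: cvgD; [exact: cf|exact: cg]. Qed.

Local Lemma fst_continuous : continuous (fun x : X => x.1).
Proof. by move=> x; exact: cvg_fst. Qed.

Local Lemma snd_continuous : continuous (fun x : X => x.2).
Proof. by move=> x; exact: cvg_snd. Qed.

Lemma prod_main_linear : linear prod_main.
Proof.
move=> a x y; rewrite /prod_main /= !linearP; congr (_, _).
by rewrite /= scalerDr addrACA.
Qed.

Lemma prod_main_continuous : continuous prod_main.
Proof.
apply: pair_continuous.
  exact: comp_continuous fst_continuous (@cl_continuous _ _ _ A1).
apply: add_continuous.
  apply: comp_continuous (@cl_continuous _ _ _ B2).
  exact: comp_continuous fst_continuous (@cl_continuous _ _ _ C1).
exact: comp_continuous snd_continuous (@cl_continuous _ _ _ A2).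
Qed.

Lemma prod_control_linear : linear prod_control.
Proof. by move=> a x y; rewrite /prod_control /= !linearP. Qed.

Lemma prod_control_continuous : continuous prod_control.
Proof.
apply: pair_continuous; first exact: cl_continuous.
exact: comp_continuous (@cl_continuous _ _ _ D1) (@cl_continuous _ _ _ B2).
Qed.

Lemma prod_observation_linear : linear prod_observation.
Proof.
by move=> a x y; rewrite /prod_observation /= !linearP /= scalerDr addrACA.
Qed.

Lemma prod_observation_continuous : continuous prod_observation.
Proof.
apply: add_continuous.
  apply: comp_continuous (@cl_continuous _ _ _ D2).
  exact: comp_continuous fst_continuous (@cl_continuous _ _ _ C1).
exact: comp_continuous snd_continuous (@cl_continuous _ _ _ C2).
Qed.

Lemma prod_feedthrough_linear : linear prod_feedthrough.
Proof. by move=> a x y; rewrite /prod_feedthrough !linearP. Qed.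

Lemma prod_feedthrough_continuous : continuous prod_feedthrough.
Proof.
exact: comp_continuous (@cl_continuous _ _ _ D1) (@cl_continuous _ _ _ D2).
Qed.

Definition product_system : system U Y (k1 + k2) :=
  {| state := (state Sigma1 * state Sigma2)%type ;
     state_index := neg_index_prod (state_index Sigma1) (state_index Sigma2) ;
     main_op := ContLinear prod_main_linear prod_main_continuous ;
     control_op := ContLinear prod_control_linear prod_control_continuous ;
     observation_op := ContLinear prod_observation_linear prod_observation_continuous ;
     feedthrough_op := ContLinear prod_feedthrough_linear prod_feedthrough_continuous |}.

End ProductSystem.

Section Decomposition.
Context {K : numClosedFieldType} {U Y1 Y : hilbertType K}.
Variables (S : K -> 'L(U, Y)) (S1 : K -> 'L(U, Y1)) (S2 : K -> 'L(Y1, Y)).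

(* S is the meromorphic function S2 S1 *)
Definition is_product : Prop :=
  meromorphic_in_disc S /\
  eq_near0 (fun z => S z : U -> Y) (fun z => S2 z \o S1 z).

Variables (H : rk_space S) (H1 : rk_space S1) (H2 : rk_space S2).

Definition mul_fun (h1 : H1) (z : K) : Y := S2 z (rk_eval h1 z).

(* H(S) = S2 H(S1) (+) H(S2): both summands are contained in H(S), which is
   their orthogonal direct sum; H(S2) keeps its own inner product. *)
Definition product_decomposition : Prop :=
  [/\ forall h1 : H1, exists h : H, eq_near0 (rk_eval h) (mul_fun h1),
      exists iota : H2 -> H,
        (forall h2, eq_near0 (rk_eval (iota h2)) (rk_eval h2)) /\
        isometry (@ip K H) (@ip K H2) iota &
      orthogonal_sum (@ip K H)
        [set h : H | exists h1 : H1, eq_near0 (rk_eval h) (mul_fun h1)]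
        [set h : H | exists h2 : H2, eq_near0 (rk_eval h) (rk_eval h2)]].

Definition multiplication_isometry : Prop :=
  exists M : H1 -> H,
    (forall h1, eq_near0 (rk_eval (M h1)) (mul_fun h1)) /\
    isometry (@ip K H) (@ip K H1) M.

End Decomposition.

(* Main.v *)
Require Import Defs.
From mathcomp Require Import all_boot all_order all_algebra.
From mathcomp Require Import all_classical all_reals all_analysis.
From HB Require Import structures.
From mathcomp Require Import ring.

(** The theorem is a comparison of two models of the same state space. For a
system with main operator A and observation operator C, the function attached
to a state x is z |-> C (I - zA)^-1 x near 0 ([state_output]). If the system is
a co-isometric and observable realization of S, this assignment is a unitary
map from the state space onto H(S) ([canonical_model]). Indeed, if k(w,f) is
the state that represents the functional x |-> <C (I - wA)^-1 x, f>, then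
co-isometry gives C (I - zA)^-1 k(w,f) = K_S(w,z) f ([coisometric_kernel]), so
the vectors k(w,f) have the same Gram matrix as the kernels K_S(w,.)f;
observability says that no nonzero state is orthogonal to all of them, and the
reproducing property says the same in H(S).

Passing from equal Gram matrices to a unitary map ([gram_unitary]) is the one
place where Pontryagin spaces differ from Hilbert spaces, as an isometric
relation with dense domain and range could be unbounded. It is bounded because
the index is finite ([isometric_relation_bounded]): a maximal negative
orthonormal family inside the relation splits off the negative part on both
sides, on the orthogonal complement of that family the form is nonnegative by
maximality and density, and there a Cauchy-Schwarz argument makes it equivalent
to the square of the norm ([neg_complement_positive]). Density is always
obtained from the absence of orthogonal vectors ([dense_of_orthogonal]).

The system operator of a product is the system operator of the first factor,
extended by the identity of the second state space, followed by that of the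
second factor, extended by the identity of the first state space. Hence a
product of co-isometric systems is always co-isometric ([product_coisometric]),
and it realizes S2 S1 ([product_transfer_function]); conditions (i) and (ii)
express its observability. The function attached to a state (x1, x2) of the
product is S2 h1 + h2, where h1 and h2 are the functions attached to x1 and x2
([product_state_output]). If the product is observable, its canonical model
carries the orthogonal sum of the two state spaces to H(S), the first summand
to S2 H(S1) and the second to H(S2), which is (i) and (ii). Conversely, if
S2 h1 + h2 = 0, then (i) makes both terms vanish and the isometries in (i) and
(ii) give x1 = 0 and x2 = 0. *)

Set Implicit Arguments.
Unset Strict Implicit.
Unset Printing Implicit Defensive.

Import Order.TTheory GRing.Theory Num.Theory.
Import numFieldNormedType.Exports.

Local Open Scope classical_set_scope.
Local Open Scope ring_scope.

(** Naming the canonical structure, instead of recovering it from the carrier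
R[i], keeps the structures of spaces over it syntactically equal, as rewriting
requires. *)
Local Notation complex_field R := (complex_complex__canonical__Num_ClosedField R).

(** * Subspaces and linear spans *)

Section Subspace.
Context {K : numClosedFieldType} {V : lmodType K} {M : set V}.
Hypothesis sM : Defs.subspace M.

Lemma subspace0 : M 0.
Proof. exact: ((subspaceP M).1 sM).1. Qed.

Lemma subspaceD x y : M x -> M y -> M (x + y).
Proof. by move=> Mx My; rewrite -[x]scale1r; exact: ((subspaceP M).1 sM).2. Qed.

Lemma subspaceZ a x : M x -> M (a *: x).
Proof.
move=> Mx; rewrite -[a *: x]addr0; apply: ((subspaceP M).1 sM).2 => //.
exact: subspace0.
Qed.

Lemma subspaceB x y : M x -> M y -> M (x - y).
Proof. by move=> Mx My; rewrite -scaleN1r; apply/subspaceD/subspaceZ. Qed.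

Lemma subspace_sum n (F : 'I_n -> V) : (forall i, M (F i)) -> M (\sum_i F i).
Proof.
move=> MF; elim/big_ind : _ => //; [exact: subspace0|exact: subspaceD].
Qed.

End Subspace.

Section LinSpan.
Context {K : numClosedFieldType} {V : lmodType K}.
Implicit Types M N : set V.

Lemma lin_span_subspace M : Defs.subspace (lin_span M).
Proof.
apply/(subspaceP (lin_span M)); split.
  by exists 0%N, (fun=> 0), (fun=> 0); split=> [[]//|]; rewrite big_ord0.
move=> a _ _ [n [b [g [Mg ->]]]] [n' [b' [g' [Mg' ->]]]].
pose c (i : 'I_(n + n')) := match fintype.split i with inl u => a * b u | inr v => b' v end.
pose f (i : 'I_(n + n')) := match fintype.split i with inl u => g u | inr v => g' v end.
exists (n + n')%N, c, f; split=> [i|]; first by rewrite /f; case: fintype.split.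
rewrite big_split_ord scaler_sumr /=; congr (_ + _); apply: eq_bigr => i _.
  by rewrite scalerA /c /f -[lshift n' i]/(unsplit (inl i)) unsplitK.
by rewrite /c /f -[rshift n i]/(unsplit (inr i)) unsplitK.
Qed.

Lemma sub_lin_span M : M `<=` lin_span M.
Proof.
move=> x Mx; exists 1%N, (fun=> 1), (fun=> x); split=> //.
by rewrite big_ord1 scale1r.
Qed.

Lemma lin_span_sub M N : Defs.subspace N -> M `<=` N -> lin_span M `<=` N.
Proof.
move=> sN MN _ [n [a [g [Mg ->]]]]; apply: subspace_sum => // i.
exact/subspaceZ/MN.
Qed.

End LinSpan.

Lemma subspace_dom (K : numClosedFieldType) (V W : lmodType K) (G : set (V * W)) :
  Defs.subspace G -> Defs.subspace [set x | exists y, G (x, y)].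
Proof.
move=> sG; apply/subspaceP; split; first by exists 0; exact: (subspace0 sG).
move=> a u v [y Gu] [z Gv]; exists (a *: y + z).
exact: ((subspaceP _).1 sG).2 a _ _ Gu Gv.
Qed.

Lemma subspace_ran (K : numClosedFieldType) (V W : lmodType K) (G : set (V * W)) :
  Defs.subspace G -> Defs.subspace [set y | exists x, G (x, y)].
Proof.
move=> sG; apply/subspaceP; split; first by exists 0; exact: (subspace0 sG).
move=> a u v [y Gu] [z Gv]; exists (a *: y + z).
exact: ((subspaceP _).1 sG).2 a _ _ Gu Gv.
Qed.

Lemma linear_sub (K : numFieldType) (V W : lmodType K) (T : V -> W) :
  linear T -> forall x y, T (x - y) = T x - T y.
Proof.
move=> lT x y; have := lT (-1) y x; rewrite !scaleN1r => TE.
by rewrite addrC TE addrC.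
Qed.

Lemma linear_scale (K : numFieldType) (V W : lmodType K) (T : V -> W) :
  linear T -> forall a x, T (a *: x) = a *: T x.
Proof.
move=> lT a x; have T0 : T 0 = 0 by rewrite -(subrr 0) linear_sub// subrr.
by rewrite -[a *: x]addr0 lT T0 addr0.
Qed.

(** * Hermitian forms and fundamental symmetries *)

Section HermitianForm.
Context {K : numClosedFieldType} {V : lmodType K}.
Variable f : {hermitian V for false & Num.conj_op}.

Lemma herm_conj x y : f x y = (f y x)^*.
Proof. by rewrite (hermC f x y) expr0 mul1r. Qed.

Lemma hermDl x y z : f (x + y) z = f x z + f y z.
Proof. exact: linearDl. Qed.
Lemma hermDr x y z : f x (y + z) = f x y + f x z.
Proof. exact: linearDr. Qed.
Lemma hermBl x y z : f (x - y) z = f x z - f y z.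
Proof. exact: linearBl. Qed.
Lemma hermBr x y z : f x (y - z) = f x y - f x z.
Proof. exact: linearBr. Qed.
Lemma hermZl a x y : f (a *: x) y = a * f x y.
Proof. exact: linearZl_LR. Qed.
Lemma hermZr a x y : f x (a *: y) = a^* * f x y.
Proof. exact: linearZr_LR. Qed.
Lemma herm0l x : f 0 x = 0.
Proof. exact: linear0l. Qed.
Lemma herm0r x : f x 0 = 0.
Proof. exact: linear0r. Qed.
Lemma herm_suml n (F : 'I_n -> V) y : f (\sum_i F i) y = \sum_i f (F i) y.
Proof. exact: linear_sumlz. Qed.
Lemma herm_sumr n (F : 'I_n -> V) y : f y (\sum_i F i) = \sum_i f y (F i).
Proof. exact: linear_sumr. Qed.

Lemma herm_orthC x y : f x y = 0 -> f y x = 0.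
Proof. by move=> xy; rewrite herm_conj xy rmorph0. Qed.

Lemma herm_real x : f x x \is Num.real.
Proof. by apply/CrealP; rewrite -herm_conj. Qed.

(** Positivity is only asked on the span of x and y, so that the inequality
applies to an indefinite form on a subspace where it is nonnegative. *)
Lemma cauchy_schwarz x y :
  (forall a b, 0 <= f (a *: x + b *: y) (a *: x + b *: y)) ->
  `|f x y| ^+ 2 <= f x x * f y y.
Proof.
move=> pos.
have E a b : f (a *: x + b *: y) (a *: x + b *: y) =
    a * a^* * f x x + a * b^* * f x y + (b * a^* * (f x y)^* + b * b^* * f y y).
  by rewrite !hermDl !hermDr !hermZl !hermZr (herm_conj y x) !mulrA.
have a0 : 0 <= f x x by have := pos 1 0; rewrite scale1r scale0r addr0.
have b0 : 0 <= f y y by have := pos 0 1; rewrite scale1r scale0r add0r.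
set t := f x y in E *; set p := f x x in E a0 *; set q := f y y in E b0 *.
have pC : p^* = p by apply/CrealP; exact: ger0_real.
have qC : q^* = q by apply/CrealP; exact: ger0_real.
(* With q = 0 the combination |t|^2 x - (p + 1) t y has square
   -|t|^4 (p + 2); otherwise q x - t y has square q (p q - |t|^2). *)
have [q0|q0] := eqVneq q 0.
  rewrite q0 mulr0; set T := `|t| ^+ 2.
  have T0 : 0 <= T by rewrite exprn_ge0.
  have TC : T^* = T by apply/CrealP; exact: ger0_real.
  have TE : T = t * t^* by rewrite /T normCK.
  clearbody T; have := pos T (- ((p + 1) * t)); rewrite E !rmorphN !rmorphM rmorphD rmorph1 /=.
  rewrite pC TC q0 mulr0 addr0.
  have -> : T * T * p + T * - ((p + 1) * t^*) * t + - ((p + 1) * t) * T * t^*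
      = - (T ^+ 2 * (p + 2)).
    by rewrite TE; ring.
  rewrite oppr_ge0 pmulr_lle0; last by rewrite ltr_wpDl.
  by rewrite real_exprn_even_le0 ?ger0_real//= => /eqP ->.
have := pos q (- t); rewrite E !rmorphN qC.
have -> : q * q * p + q * - t^* * t + (- t * q * t^* + - t * - t^* * q)
    = q * (p * q - t * t^*) by ring.
by rewrite pmulr_rge0 ?lt_def ?q0// subr_ge0 normCK.
Qed.
End HermitianForm.

Section FundamentalSymmetry.
Context {K : numClosedFieldType} {X : pontryaginType K}.

(** A fundamental decomposition X+ + X- gives the symmetry J = P+ - P-, which
turns the indefinite form into the positive form j of the Hilbert space
X+ + (-X-). The later arguments use J and j only, never the decomposition. *)
Lemma fundamental_symmetry : exists (J : X -> X)
    (j : {hermitian X for false & Num.conj_op}) (c d : K),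
  [/\ forall x y, j x y = '[x, J y], forall x y, '[x, y] = j x (J y),
      0 < c, 0 < d & forall x, c * `|x| ^+ 2 <= j x x <= d * `|x| ^+ 2].
Proof.
have [k [Vp [Vm [[sp sm spl int orth] pos neg _ [c [d [c0 d0 cd]]]]]]] :=
  @pontryagin_subproof K X.
have /choice[P PE] (x : X) : exists p : X, Vp p /\ Vm (x - p).
  by have [m [n [Vm' Vn ->]]] := spl x; exists m; rewrite addrC addKr.
have Pu x p : Vp p -> Vm (x - p) -> P x = p.
  have [Px PNx] := PE x; move=> Vpp Vmp; apply/eqP; rewrite -subr_eq0; apply/eqP.
  apply: int; first exact: subspaceB.
  have -> : P x - p = (x - p) - (x - P x) by rewrite opprB [RHS]addrC addrA subrK.
  exact: subspaceB.
have Pl : linear P.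
  move=> a x y; have [? ?] := PE x; have [? ?] := PE y.
  apply: Pu; first by apply: subspaceD => //; exact: subspaceZ.
  by rewrite opprD addrACA -scalerBr; apply: subspaceD => //; exact: subspaceZ.
have [N NE] : exists N : X -> X, forall x, N x = x - P x by exists (fun x => x - P x).
have Nl : linear N.
  by move=> a x y; rewrite !NE Pl opprD addrACA -scalerBr.
have PN x : x = P x + N x by rewrite NE addrC subrK.
have PN0 x y : '[P x, N y] = 0 by rewrite NE; apply: orth; [exact: (PE x).1|exact: (PE y).2].
have NP0 x y : '[N x, P y] = 0 by apply: herm_orthC.
have [J JE] : exists J : X -> X, forall x, J x = P x - N x
  by exists (fun x => P x - N x).
have Jl : linear J.
  by move=> a x y; rewrite !JE Pl Nl opprD addrACA -scalerBr.
have jE x y : '[x, J y] = '[P x, P y] - '[N x, N y].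
  by rewrite {1}(PN x) JE hermDl !hermBr PN0 NP0 subr0 sub0r.
have PJ x : P (J x) = P x.
  apply: Pu; first exact: (PE x).1.
  rewrite JE addrAC subrr add0r -scaleN1r NE; apply: subspaceZ => //.
  exact: (PE x).2.
have NJ x : N (J x) = - N x by rewrite NE PJ JE addrAC subrr add0r.
have jbil : bilinear_for *%R (Num.conj_op \; *%R) (fun x y => '[x, J y]).
  split=> [q a x y|p a x y] /=; first by rewrite hermDl hermZl.
  by rewrite Jl hermDr hermZr.
have jherm x y : '[x, J y] = (-1) ^+ false * Num.conj_op '[y, J x].
  by rewrite expr0 mul1r !jE rmorphB /= -!herm_conj.
pose j : {hermitian X for false & Num.conj_op} := HB.pack (fun x y => '[x, J y])
  (bilinear_isBilinear.Build K X X K _ _ _ jbil)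
  (isHermitianSesquilinear.Build K X false Num.conj_op _ jherm).
exists J, j, c, d; split=> //.
  move=> x y; rewrite -[RHS]/('[x, J (J y)]) jE PJ NJ linearNr opprK.
  by rewrite {1}(PN x) {1}(PN y) hermDl !hermDr PN0 NP0 addr0 add0r.
move=> x; rewrite -[j x x]/('[x, J x]) jE {1 10}(PN x).
by rewrite NE; apply: cd; [exact: (PE x).1|exact: (PE x).2].
Qed.

Lemma fundamental_symmetry_norm (J : X -> X)
    (j : {hermitian X for false & Num.conj_op}) :
  (forall x y, j x y = '[x, J y]) -> (forall x y, '[x, y] = j x (J y)) ->
  forall x, j (J x) (J x) = j x x.
Proof. by move=> jE ipE x; rewrite -ipE herm_conj -jE -herm_conj. Qed.

Lemma ip_bounded : exists C : K,
  0 < C /\ forall x y : X, `|'[x, y]| <= C * (`|x| * `|y|).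
Proof.
have [J [j [c [d [jE ipE c0 d0 cd]]]]] := fundamental_symmetry.
have jpos x : 0 <= j x x.
  by have /andP[+ _] := cd x; apply: le_trans; rewrite mulr_ge0 ?exprn_ge0 ?(ltW c0).
exists d; split=> // x y.
rewrite -(@ler_pXn2r _ 2)// ?nnegrE ?mulr_ge0 ?normr_ge0 ?(ltW d0)//.
rewrite ipE; apply: le_trans (cauchy_schwarz (fun a b => jpos _)) _.
rewrite (fundamental_symmetry_norm jE ipE).
have -> : (d * (`|x| * `|y|)) ^+ 2 = (d * `|x| ^+ 2) * (d * `|y| ^+ 2).
  by ring.
by apply: ler_pM => //; have /andP[] := cd x; have /andP[] := cd y.
Qed.

End FundamentalSymmetry.

(** * Closures and limits in normed spaces *)

Section Epsilon.
Context {K : numFieldType}.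

(** The order of K is partial, but positive elements are comparable. *)
Lemma pos_min (a b : K) : 0 < a -> 0 < b -> exists e : K, [/\ 0 < e, e <= a & e <= b].
Proof.
move=> a0 b0; have /orP[ab|ba] := real_leVge (gtr0_real a0) (gtr0_real b0).
  by exists a.
by exists b.
Qed.

Lemma small_eq0 (a b : K) : 0 <= a -> 0 <= b ->
  (forall e : K, 0 < e -> e <= 1 -> a <= e * b) -> a = 0.
Proof.
move=> a0 b0 small; apply/eqP; apply: contraT => an0.
have a1 : 0 < a by rewrite lt_def an0.
have s0 : 0 < a + b *+ 2 by rewrite ltr_wpDr// mulrn_wge0.
have := small (a / (a + b *+ 2)); rewrite divr_gt0// => /(_ isT).
rewrite ler_pdivrMr// mul1r lerDl mulrn_wge0// => /(_ isT).
rewrite mulrAC ler_pdivlMr// ler_pM2l// mulr2n addrCA gerDl => ab.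
by have := lt_le_trans (ltr_wpDr b0 a1) ab; rewrite ltxx.
Qed.

Lemma normD2_le (V : normedZmodType K) (x y : V) :
  `|x + y| ^+ 2 <= (`|x| ^+ 2 + `|y| ^+ 2) *+ 2.
Proof.
apply: (@le_trans _ _ ((`|x| + `|y|) ^+ 2)).
  by rewrite ler_pXn2r ?nnegrE ?addr_ge0// ler_normD.
rewrite -subr_ge0 (_ : _ - _ = (`|x| - `|y|) ^+ 2); last by ring.
by rewrite real_exprn_even_ge0// realB// normr_real.
Qed.

Lemma closure_normP (V : normedModType K) (A : set V) x :
  closure A x <-> forall e : K, 0 < e -> exists y, A y /\ `|x - y| < e.
Proof.
split=> [cA e e0|AP B /nbhs_normP[e /= e0 eB]].
  have [y [Ay xy]] := cA _ (nbhsx_ballx x e e0); exists y; split=> //.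
  by move: xy; rewrite -ball_normE.
by have [y [Ay xy]] := AP e e0; exists y; split=> //; exact: eB.
Qed.

Lemma lipschitz_continuous (V W : normedModType K) (g : V -> W) (C : K) :
  0 < C -> (forall x y, `|g x - g y| <= C * `|x - y|) -> continuous g.
Proof.
move=> C0 gC x; apply/cvgrPdist_lt => e e0.
near=> y; apply: le_lt_trans (gC _ _) _.
rewrite mulrC -ltr_pdivlMr//.
near: y; apply: cvgr_dist_lt => //; exact: divr_gt0.
Unshelve. all: end_near. Qed.

(** Nested sets with diameters tending to 0 stand in for Cauchy sequences, whose
radii 1/n would require K to be archimedean. *)
Lemma nested_cvg (V : completeNormedModType K) (B : K -> set V) :
  (forall e : K, 0 < e -> B e !=set0) ->
  (forall e e' : K, 0 < e -> e <= e' -> B e `<=` B e') ->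
  (forall e : K, 0 < e -> exists2 e', 0 < e' &
     forall x y, B e' x -> B e' y -> `|x - y| < e) ->
  exists p, forall e : K, 0 < e -> exists x, B e x /\ `|p - x| < e.
Proof.
move=> B0 Bsub Bc; pose F := filter_from [set e : K | 0 < e] B.
have FF : ProperFilter F.
  apply: filter_from_proper => //; apply: filter_from_filter.
    by exists 1 => /=.
  move=> i j /= i0 j0; have [e [e0 ei ej]] := pos_min i0 j0.
  by exists e => // x Bx; split; apply: Bsub Bx.
have Fc : cauchy F.
  apply/cauchyP => e e0; have [e' e'0 Be'] := Bc e e0.
  have [x Bx] := B0 _ e'0; exists x; exists e' => // y By.
  by rewrite -ball_normE /=; exact: Be'.
have Fp : F --> lim F := @cauchy_cvg V F FF Fc.
move: (lim F) Fp => p Fp; exists p => e e0; have [e' /= e'0 e'B] := Fp _ (nbhsx_ballx p e e0).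
have [m [m0 me me']] := pos_min e0 e'0.
have [x Bx] := B0 _ m0; exists x; split; first exact: Bsub Bx.
by have := e'B _ (Bsub _ _ m0 me' _ Bx); rewrite -ball_normE.
Qed.

Lemma closure_prodP (V W : normedModType K) (G : set (V * W)) x h :
  (forall e : K, 0 < e -> exists d g, [/\ G (d, g), `|x - d| < e & `|h - g| < e]) ->
  closure G (x, h).
Proof.
move=> near_G B [[B1 B2] [/= /nbhs_normP[e1 /= e10 eB1] /nbhs_normP[e2 /= e20 eB2]] B12].
have [e [e0 ee1 ee2]] := pos_min e10 e20.
have [d [g [Gdg xd hg]]] := near_G e e0; exists (d, g); split=> //; apply: B12.
by split; [apply: eB1|apply: eB2]; exact: lt_le_trans (_ : _ < e) _.
Qed.

End Epsilon.

(** Extension by continuity, for the relation G in place of its operator: the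
values of G over a small ball around x have small diameter. *)
Lemma bounded_relation_total (K : numClosedFieldType) (V : normedModType K)
    (W : completeNormedModType K) (G : set (V * W)) (C : K) :
  0 < C -> Defs.subspace G -> (forall d g, G (d, g) -> `|g| <= C * `|d|) ->
  closure [set d | exists g, G (d, g)] = setT ->
  forall x, exists h, closure G (x, h).
Proof.
move=> C0 sG GC dG x.
pose B (e : K) := [set g : W | exists d, G (d, g) /\ `|x - d| < e].
have [e e0|e e' e0 ee' g [d [Gdg xd]]|e e0|h hB] := @nested_cvg K W B.
- have : closure [set d | exists g, G (d, g)] x by rewrite dG.
  by move=> /closure_normP /(_ e e0)[d [[g Gdg] xd]]; exists g, d.
- by exists d; split=> //; exact: lt_le_trans ee'.
- exists (e / (C *+ 2)); first by rewrite divr_gt0 ?pmulrn_lgt0.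
  move=> g g' [d [Gd xd]] [d' [Gd' xd']].
  have : G (d - d', g - g') by exact: (subspaceB sG Gd Gd').
  move=> /GC /le_lt_trans; apply.
  rewrite mulrC -ltr_pdivlMr// (_ : e / C = e / (C *+ 2) + e / (C *+ 2)); last first.
    by rewrite -mulr2n -mulr_natr; field; rewrite gt_eqF.
  rewrite -(subrK x d) -addrA; apply: le_lt_trans (ler_normD _ _) _.
  by rewrite ltrD// distrC.
exists h; apply: closure_prodP => e /hB[g [[d [Gdg xd]] hg]].
by exists d, g.
Qed.

Lemma bounded_continuous (K : numFieldType) (V W : normedModType K) (T : V -> W)
    (C : K) : 0 < C -> linear T -> (forall x, `|T x| <= C * `|x|) -> continuous T.
Proof.
by move=> C0 lT TC; apply: (lipschitz_continuous C0) => x y; rewrite -linear_sub.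
Qed.

Lemma linear_bounded (K : numFieldType) (V W : normedModType K) (T : V -> W) :
  linear T -> continuous T -> exists C : K, 0 < C /\ forall x, `|T x| <= C * `|x|.
Proof.
move=> lT cT; pose L := GRing.isLinear.Build K V W *:%R T lT.
pose f : {linear V -> W} := HB.pack T L.
have /linear_boundedP/pinfty_ex_gt0[r r0 fr] := @continuous_linear_bounded K V W 0 f (cT 0).
by exists r.
Qed.

Lemma closed_equalizer (K : numFieldType) (T : topologicalType) (V : normedModType K)
    (f g : T -> V) : continuous f -> continuous g -> closed [set x | f x = g x].
Proof.
move=> cf cg.
have -> : [set x | f x = g x] = (fun x => f x - g x) @^-1` [set 0].
  apply/seteqP; split=> x /= => [->|/eqP]; first by rewrite subrr.
  by rewrite subr_eq0 => /eqP.
apply: preimage_closed.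
  by move=> x _; apply: cvgB; [exact: cf|exact: cg].
by apply: accessible_closed_set1; apply: hausdorff_accessible; exact: norm_hausdorff.
Qed.

(** The form in which continuity of the inner product is used for limits of
relations and of spans. *)
Lemma closure_equalizer (K : numFieldType) (T : topologicalType) (V : normedModType K)
    (f g : T -> V) (M : set T) : continuous f -> continuous g ->
  (forall x, M x -> f x = g x) -> forall x, closure M x -> f x = g x.
Proof.
move=> cf cg fg x Mx; apply: (closed_equalizer cf cg).
by apply: closureS Mx => y /fg.
Qed.

Section ContLinear.
Context {K : numClosedFieldType} {V W : normedModType K} (T : 'L(V, W)).

Lemma cl_add x y : T (x + y) = T x + T y.
Proof. exact: linearD. Qed.
Lemma cl_sub x y : T (x - y) = T x - T y.
Proof. exact: linearB. Qed.
Lemma cl_scale a x : T (a *: x) = a *: T x.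
Proof. exact: linearZ. Qed.
Lemma cl_zero : T 0 = 0.
Proof. exact: linear0. Qed.

End ContLinear.

(** * Density and the Riesz theorem *)

Section InnerProductTopology.
Context {K : numClosedFieldType} {X : pontryaginType K}.
Implicit Types x y : X.

Lemma ip_nondegenerate x : (forall y, '[y, x] = 0) -> x = 0.
Proof.
have [J [j [c [d [jE ipE c0 d0 cd]]]]] := @fundamental_symmetry K X.
move=> x0; apply/eqP; rewrite -normr_eq0 -sqrf_eq0; apply/eqP/le_anti.
rewrite exprn_ge0// andbT.
have /andP[+ _] := cd x; rewrite jE (herm_orthC (x0 _)).
by rewrite pmulr_rle0.
Qed.

Lemma ip_inj x x' : (forall y, '[y, x] = '[y, x']) -> x = x'.
Proof.
move=> xx'; apply/eqP; rewrite -subr_eq0; apply/eqP/ip_nondegenerate => y.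
by rewrite hermBr xx' subrr.
Qed.

Lemma ip_injl x x' : (forall y, '[x, y] = '[x', y]) -> x = x'.
Proof. by move=> xx'; apply: ip_inj => y; rewrite herm_conj xx' -herm_conj. Qed.

Lemma ip_continuousl y : continuous (fun x => '[x, y]).
Proof.
have [C [C0 ipC]] := @ip_bounded K X.
apply: (@lipschitz_continuous _ X K^o _ (C * (`|y| + 1))).
  by rewrite mulr_gt0// ltr_wpDl.
move=> a b; rewrite -hermBl; apply: le_trans (ipC _ _) _.
by rewrite -mulrA ler_wpM2l ?(ltW C0)// mulrC ler_wpM2r// lerDl.
Qed.

Lemma ip_continuous_diag : continuous (fun x => '[x, x]).
Proof.
have [C [C0 ipC]] := @ip_bounded K X.
move=> x; apply/(@cvgrPdist_lt _ K^o) => e e0.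
have D0 : 0 < C * (`|x| *+ 2 + 1) by rewrite mulr_gt0// ltr_wpDl// mulrn_wge0.
near=> y.
have -> : '[x, x] - '[y, y] = '[x, x - y] + '[x - y, y].
  by rewrite hermBr hermBl addrA subrK.
apply: le_lt_trans (ler_normD _ _) _.
apply: le_lt_trans (lerD (ipC _ _) (ipC _ _)) _.
have yx : `|y| <= `|x| + 1.
  rewrite -lerBlDl; apply: le_trans (lerB_dist _ _) _; rewrite distrC.
  near: y; apply: cvgr_dist_le => //.
apply: (@le_lt_trans _ _ (C * (`|x| *+ 2 + 1) * `|x - y|)).
  rewrite -mulrDr -mulrA ler_wpM2l ?(ltW C0)// mulrC -mulrDr mulrC ler_wpM2r//.
  by rewrite mulr2n -addrA lerD2l.
rewrite mulrC -ltr_pdivlMr//; near: y; apply: cvgr_dist_lt => //.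
exact: divr_gt0.
Unshelve. all: end_near. Qed.

End InnerProductTopology.

Section Density.
Context {R : realType}.
Local Notation K := (complex_field R).
Context {X : pontryaginType K}.

(** For y in X, elements of M that nearly minimize the j-distance to y are
close to each other and converge to some p in the closure of M. The vector
y - p is j-orthogonal to M, so J (y - p) is orthogonal to M and vanishes. *)
Lemma dense_of_orthogonal (M : set X) : Defs.subspace M ->
  (forall x, (forall m, M m -> '[m, x] = 0) -> x = 0) -> closure M = setT.
Proof.
move=> sM M0; apply/seteqP; split=> // y _.
have [J [j [c [d [jE ipE c0 d0 cd]]]]] := @fundamental_symmetry K X.
have jpos x : 0 <= j x x.
  by have /andP[+ _] := cd x; apply: le_trans; rewrite mulr_ge0 ?exprn_ge0 ?(ltW c0).
have j0 x : j x x = 0 -> x = 0.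
  move=> jx0; have /andP[+ _] := cd x; rewrite jx0 pmulr_rle0//.
  by rewrite real_exprn_even_le0 ?normr_real//= normr_eq0 => /eqP.
have jcs x z : `|j x z| ^+ 2 <= j x x * j z z by exact: cauchy_schwarz.
pose D := [set complex.Re (j (y - m) (y - m)) | m in M].
have D0 : has_inf D.
  split; first by exists (complex.Re (j (y - 0) (y - 0))), 0 => //; exact: subspace0.
  exists 0 => _ [m Mm <-].
  by have := jpos (y - m); rewrite lecE => /andP[].
pose delta : K := ((inf D)%:C)%C.
have dle m : M m -> delta <= j (y - m) (y - m).
  move=> Mm; have := jpos (y - m); rewrite !lecE => /andP[/= /eqP im _].
  by rewrite im eqxx /=; apply: ge_inf; [exact: D0.2|exists m].
pose B (e : K) := [set m | M m /\ j (y - m) (y - m) <= delta + e].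
have Bne e : 0 < e -> B e !=set0.
  rewrite ltcE => /andP[/= /eqP ime ree].
  have [_ [m Mm <-] me] := inf_adherent ree D0.
  exists m; split=> //; have := jpos (y - m); rewrite !lecE => /andP[/= /eqP im _].
  case: e ime ree me => er ei /= -> _ me; rewrite im addr0 eqxx /=.
  exact: ltW.
(* If m minimizes the squared distance up to e, then moving m by
   (t / b) n, the best step in the direction n, gains |t|^2 / b <= e. *)
have B1 e m n : 0 < e -> B e m -> M n -> `|j (y - m) n| ^+ 2 <= e * j n n.
  move=> e0 [Mm me] Mn.
  have [n0|n0] := eqVneq (j n n) 0.
    by rewrite (j0 _ n0) !herm0r normr0 mulr0 expr0n.
  set t := j (y - m) n; set b := j n n in n0 *.
  have b0 : 0 < b by rewrite lt_def n0 /=; exact: jpos.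
  have bC : b^* = b by rewrite -herm_conj.
  have := dle _ (subspaceD sM Mm (subspaceZ sM (t / b) Mn)).
  rewrite /t opprD addrA => {}dle; rewrite -ler_pdivrMr// -/t normCK.
  rewrite -(lerD2l delta); apply: le_trans me; rewrite -lerBrDr.
  apply: le_trans dle _; rewrite /t; move: (y - m) @t => u t.
  rewrite hermBl !hermBr !hermZl !hermZr -/b -/t (herm_conj _ n u) -/t.
  have -> : (t / b)^* = t^* / b by rewrite rmorphM fmorphV /= bC.
  rewrite le_eqVlt; apply/orP; left; apply/eqP.
  by field.
have B2 e m n : 0 < e -> B e m -> B e n -> c * `|m - n| ^+ 2 <= e *+ 4.
  move=> e0 Bm Bn; have /andP[+ _] := cd (m - n); move=> /le_trans; apply.
  have Mmn : M (m - n) by apply: subspaceB Bm.1 Bn.1.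
  have := B1 e n _ e0 Bn Mmn; have := B1 e m _ e0 Bm Mmn.
  have jE2 : j (m - n) (m - n) = j (y - n) (m - n) + j (- (y - m)) (m - n).
    by rewrite -hermDl; congr (j _ _); rewrite opprB [RHS]addrC addrA subrK.
  have := normD2_le (j (y - n) (m - n)) (j (- (y - m)) (m - n)); rewrite -jE2.
  rewrite linearNl normrN => l1 l2 l3.
  have [->|q0] := eqVneq (j (m - n) (m - n)) 0; first by rewrite mulrn_wge0// ltW.
  have q1 : 0 < j (m - n) (m - n) by rewrite lt_def q0 jpos.
  rewrite -(ler_pM2r q1) -expr2 -[X in X ^+ 2]ger0_norm//.
  apply: le_trans l1 _; have := lerD l3 l2.
  rewrite -mulr2n => /(ler_wMn2r 2); rewrite -mulrnA mulrnAl; apply.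
have [e e' e0 ee' m [Mm me]|e e0|p pB] := @nested_cvg K X B Bne.
- by split=> //; apply: le_trans me _; rewrite lerD2l.
- exists (c * e ^+ 2 / 8); first by rewrite divr_gt0// mulr_gt0// exprn_gt0.
  move=> m n Bm Bn.
  rewrite -(@ltr_pXn2r _ 2)// ?nnegrE ?normr_ge0 ?(ltW e0)//.
  rewrite -(ltr_pM2l c0); apply: le_lt_trans (B2 _ _ _ _ Bm Bn) _.
    by rewrite divr_gt0// mulr_gt0// exprn_gt0.
  have -> : c * e ^+ 2 / 8 *+ 4 = c * e ^+ 2 / 2 by rewrite -mulr_natr; field.
  by rewrite ltr_pdivrMr// ltr_pMr ?ltr1n// mulr_gt0// exprn_gt0.
have yp : y - p = 0.
  suff Jyp : J (y - p) = 0 by apply: ip_nondegenerate => x; rewrite ipE Jyp herm0r.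
  apply: M0 => n Mn; rewrite -jE; apply: herm_orthC.
  apply/eqP; rewrite -normr_eq0 -sqrf_eq0; apply/eqP.
  apply: (@small_eq0 _ _ ((1 + d) * j n n *+ 2)); rewrite ?exprn_ge0//.
    by rewrite mulrn_wge0// mulr_ge0// addr_ge0// ltW.
  move=> e e0 e1; have [m [Bm pm]] := pB e e0.
  rewrite -(subrK m y) -addrA hermDl.
  have u2 : `|j (m - p) n| ^+ 2 <= e * d * j n n.
    apply: le_trans (jcs _ _) _; apply: ler_wpM2r => //.
    have /andP[_ /le_trans] := cd (m - p); apply.
    rewrite mulrC ler_wpM2r ?(ltW d0)// distrC.
    apply: (@le_trans _ _ (e ^+ 2)); last by rewrite expr2 ler_piMr ?(ltW e0).
    by rewrite lerXn2r ?nnegrE ?(ltW e0) ?(ltW pm).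
  apply: le_trans (normD2_le _ _) _; rewrite mulrnAr lerMn2r/= mulrA mulrDr mulr1 mulrDl.
  by rewrite lerD// B1.
have -> : y = p by apply/eqP; rewrite -subr_eq0 yp.
by apply/closure_normP => e /pB[m [[Mm _] pm]]; exists m.
Qed.

(** The kernel of phi is closed, so if it is proper, some z <> 0 is orthogonal
to it, and phi is a multiple of the product with z. *)
Lemma riesz (phi : X -> K) : linear (phi : X -> K^o) -> continuous (phi : X -> K^o) ->
  exists z, forall x, phi x = '[x, z].
Proof.
move=> lphi cphi; pose M := [set x | phi x = 0].
have phi0 : phi 0 = 0 by have := lphi (-1) 0 0; rewrite scaler0 addr0 scaleN1r addNr.
have sM : Defs.subspace M.
  apply/(subspaceP M); split=> // a x y /= x0 y0.
  by have := lphi a x y; rewrite x0 y0 scaler0 addr0.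
have cM : closure M = M.
  apply/esym/closure_id; apply: (@closed_equalizer _ X K^o phi (fun=> 0)) => //.
  exact: cst_continuous.
have [MT|/existsNP[y My]] := pselect (forall x, M x).
  by exists 0 => x; rewrite herm0r; exact: MT.
have [z [Mz z0]] : exists z, (forall m, M m -> '[m, z] = 0) /\ z <> 0.
  apply: contrapT => nz; apply: My; rewrite -cM dense_of_orthogonal// => x Mx.
  by apply: contrapT => x0; apply: nz; exists x.
have phiE x : '[x, z] * phi y = phi x * '[y, z].
  have : M (phi x *: y - phi y *: x).
    rewrite /M /=; have := lphi (phi x) y (- phi y *: x).
    have -> : phi (- phi y *: x) = - phi y * phi x.
      by have := lphi (- phi y) x 0; rewrite phi0 !addr0.
    by rewrite scaleNr => ->; rewrite /GRing.scale /= mulNr mulrC subrr.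
  by move=> /Mz; rewrite hermBl !hermZl mulrC => /eqP; rewrite subr_eq0 => /eqP ->; rewrite mulrC.
have yz : '[y, z] != 0.
  apply: contra_notN z0 => /eqP yz; apply: ip_nondegenerate => x.
  apply/eqP; have := phiE x; rewrite yz mulr0 => /eqP.
  by rewrite mulf_eq0 => /orP[//|/eqP].
exists ((phi y / '[y, z])^* *: z) => x.
by rewrite hermZr conjCK mulrAC (mulrC (phi y)) phiE mulfK.
Qed.

End Density.

Section Adjoint.
Context {R : realType}.
Local Notation K := (complex_field R).
Context {X Y : pontryaginType K}.

Lemma adj_eq (T : X -> Y) y x' : (forall x, '[T x, y] = '[x, x']) -> adj T y = x'.
Proof.
move=> Tx'; apply: ip_inj => x.
by rewrite -(@xgetPex _ 0 [set x' | forall x, '[T x, y] = '[x, x']]) ?Tx'//; exists x'.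
Qed.

Lemma adjP (T : X -> Y) : linear T -> continuous T ->
  forall x y, '[T x, y] = '[x, adj T y].
Proof.
move=> lT cT x y.
have [|z|z zE] := @riesz R X (fun x => '[T x, y]).
- by move=> a u v; rewrite lT hermDl hermZl.
- by apply: (@continuous_comp X Y K^o T (fun y' => '[y', y])); [exact: cT|exact: ip_continuousl].
- by rewrite (adj_eq zE).
Qed.

End Adjoint.

(** * Maximal negative families *)

Section NegativeFamilies.
Context {K : numClosedFieldType}.
Implicit Types X H : pontryaginType K.

Definition negative_orthonormal X m (n : 'I_m -> X) : Prop :=
  forall i j, '[n i, n j] = - (i == j)%:R.

(** The orthogonal projection onto the complement of the family; the sign is +
because the vectors of the family have square -1. *)
Definition neg_complement X m (n : 'I_m -> X) (x : X) : X :=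
  x + \sum_i '[x, n i] *: n i.

(** If m exceeds the dimension k of X-, a nontrivial combination of the m
vectors has zero component in X-, so it lies in X+ although its square is
negative. *)
Lemma negative_orthonormal_bounded X :
  exists k, forall m (n : 'I_m -> X), negative_orthonormal n -> (m <= k)%N.
Proof.
have [k [Vp [Vm [[sp sm spl int orth] pos neg [e [eV _]] _]]]] :=
  @pontryagin_subproof K X.
exists k => m n nn; rewrite leqNgt; apply/negP => km.
have /choice[p pV] i : exists p : X, Vp p /\ Vm (n i - p).
  by have [u [v [Vu Vv ->]]] := spl (n i); exists u; rewrite addrC addKr.
have /choice[a aE] i : exists a : 'I_k -> K, n i - p i = \sum_l a l *: e l.
  exact/eV/(pV i).2.
pose A : 'M[K]_(m, k) := \matrix_(i, l) a i l.
have : kermx A != 0.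
  rewrite -mxrank_eq0 mxrank_ker subn_eq0 -ltnNge.
  exact: leq_ltn_trans (rank_leq_col A) km.
move=> /rowV0Pn[b /sub_kermxP bA b0].
pose x : X := \sum_i b 0 i *: n i.
have xV : Vp x.
  have -> : x = \sum_i b 0 i *: p i.
    apply/eqP; rewrite -subr_eq0 -sumrB; apply/eqP.
    under eq_bigr => i _ do rewrite -scalerBr aE scaler_sumr.
    rewrite exchange_big big1//= => l _.
    under eq_bigr => i _ do rewrite scalerA.
    rewrite -scaler_suml.
    have /matrixP/(_ 0 l) := bA; rewrite !mxE => bA0.
    suff -> : \sum_i b 0 i * a i l = 0 by rewrite scale0r.
    by rewrite -[RHS]bA0; apply: eq_bigr => i _; rewrite mxE.
  by apply: subspace_sum => // i; apply: subspaceZ => //; exact: (pV i).1.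
have xx : '[x, x] = - \sum_i `|b 0 i| ^+ 2.
  rewrite herm_suml -sumrN; apply: eq_bigr => i _; rewrite hermZl herm_sumr.
  rewrite (bigD1 i)//= big1 ?addr0 => [|j ji]; rewrite hermZr nn.
    by rewrite eqxx mulrN1 mulrN normCK.
  by rewrite eq_sym (negbTE ji) oppr0 mulr0.
have [i bi] : exists i, b 0 i != 0.
  apply/existsP; apply: contraNT b0 => /existsPn b0; apply/eqP/rowP => i.
  by rewrite mxE; apply/eqP/negPn/b0.
have xx0 : '[x, x] < 0.
  rewrite xx oppr_lt0 (bigD1 i)//=; apply: ltr_wpDr.
    by apply: sumr_ge0 => l _; rewrite exprn_ge0.
  by rewrite exprn_gt0// normr_gt0.
have [x0|x0] := eqVneq x 0; first by move: xx0; rewrite x0 herm0l ltxx.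
by have := lt_trans xx0 (pos _ xV x0); rewrite ltxx.
Qed.

Section Complement.
Context {X : pontryaginType K} {m : nat} (n : 'I_m -> X).
Hypothesis nn : negative_orthonormal n.
Local Notation Q := (neg_complement n).

Lemma neg_complement_linear : linear Q.
Proof.
move=> a x y; rewrite /neg_complement scalerDr addrACA; congr (_ + _).
rewrite scaler_sumr -big_split; apply: eq_bigr => i _ /=.
by rewrite hermDl hermZl scalerDl scalerA.
Qed.

Lemma neg_complement_orth x j : '[Q x, n j] = 0.
Proof.
rewrite /neg_complement hermDl herm_suml (bigD1 j)//= big1 ?addr0 => [|i ij].
  by rewrite hermZl nn eqxx mulrN1 subrr.
by rewrite hermZl nn (negbTE ij) oppr0 mulr0.
Qed.

Lemma neg_complement_ipr u x : (forall j, '[u, n j] = 0) -> '[u, Q x] = '[u, x].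
Proof.
move=> un; rewrite /neg_complement hermDr herm_sumr big1 ?addr0// => i _.
by rewrite hermZr un mulr0.
Qed.

Lemma neg_complement_bounded : exists C : K, 0 < C /\ forall x, `|Q x| <= C * `|x|.
Proof.
have [C [C0 ipC]] := @ip_bounded K X.
exists (1 + \sum_i C * (`|n i| * `|n i|)); split.
  by apply: ltr_wpDr => //; apply: sumr_ge0 => i _; rewrite mulr_ge0 ?mulr_ge0 ?(ltW C0).
move=> x; apply: le_trans (ler_normD _ _) _; rewrite mulrDl mul1r lerD2l mulr_suml.
apply: le_trans (ler_norm_sum _ _ _) _; apply: ler_sum => i _.
rewrite normrZ.
have -> : C * (`|n i| * `|n i|) * `|x| = C * (`|x| * `|n i|) * `|n i| by ring.
by rewrite ler_wpM2r// ipC.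
Qed.

Lemma neg_complement_continuous : continuous Q.
Proof.
have [C [C0 QC]] := neg_complement_bounded.
exact: bounded_continuous C0 neg_complement_linear QC.
Qed.

(** On the complement of a negative family a nonnegative form is equivalent to
the squared norm. For u in the complement, c |u|^2 <= <u, J u> = <u, Q (J u)>,
and the Cauchy-Schwarz inequality for the form on the complement bounds this by
<u, u>^(1/2) times a multiple of |u|. *)
Lemma neg_complement_positive (M : set X) : closure M = setT ->
  (forall x, M x -> 0 <= '[Q x, Q x]) ->
  exists C : K, 0 < C /\ forall x, `|Q x| ^+ 2 <= C * '[Q x, Q x].
Proof.
move=> MT Mpos.
have Qpos x : 0 <= '[Q x, Q x].
  rewrite -[X in 0 <= X](_ : `|'[Q x, Q x]| = _) ?normr_ge0//.
  have cf : continuous (fun x : X => '[Q x, Q x] : K^o).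
    move=> z; apply: (@continuous_comp X X K^o Q (fun y => '[y, y])).
      exact: neg_complement_continuous.
    exact: ip_continuous_diag.
  have cn : continuous (fun x : X => `|'[Q x, Q x]| : K^o).
    by move=> z; apply: (@cvg_norm _ K^o); exact: cf.
  apply: (closure_equalizer (M := M) cn cf); last by rewrite MT.
  by move=> z Mz; rewrite ger0_norm// Mpos.
have [J [j [c [d [jE ipE c0 d0 cd]]]]] := @fundamental_symmetry K X.
have [C [C0 ipC]] := @ip_bounded K X.
have [D [D0 QD]] := neg_complement_bounded.
have JJ x : c * `|J x| ^+ 2 <= d * `|x| ^+ 2.
  have /andP[+ _] := cd (J x); move=> /le_trans; apply.
  by rewrite (fundamental_symmetry_norm jE ipE); have /andP[] := cd x.
exists (C * D ^+ 2 * d / c ^+ 3); split.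
  by rewrite divr_gt0 ?exprn_gt0// mulr_gt0// mulr_gt0// exprn_gt0.
move=> x; set u := Q x.
have [u0|u0] := eqVneq u 0; first by rewrite u0 normr0 expr0n/= herm0l mulr0.
have un : 0 < `|u| ^+ 2 by rewrite exprn_gt0// normr_gt0.
have cs : `|'[u, Q (J u)]| ^+ 2 <= '[u, u] * '[Q (J u), Q (J u)].
  apply: cauchy_schwarz => a b.
  suff -> : a *: u + b *: Q (J u) = Q (a *: x + b *: J u) by exact: Qpos.
  by rewrite neg_complement_linear (linear_scale neg_complement_linear).
rewrite neg_complement_ipr -?jE in cs; last exact: neg_complement_orth.
have /andP[cu _] := cd u.
have cu2 : (c * `|u| ^+ 2) ^+ 2 <= `|j u u| ^+ 2.
  rewrite ler_pXn2r ?nnegrE ?mulr_ge0 ?(ltW c0) ?exprn_ge0//.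
  exact: le_trans cu (real_ler_norm (herm_real j u)).
have uu0 : 0 <= '[u, u] by exact: Qpos.
have QJ : '[Q (J u), Q (J u)] <= C * (D ^+ 2 * (d / c * `|u| ^+ 2)).
  apply: le_trans (real_ler_norm (herm_real _ _)) _.
  apply: le_trans (ipC _ _) _; rewrite ler_wpM2l ?(ltW C0)// -expr2.
  apply: (@le_trans _ _ ((D * `|J u|) ^+ 2)).
    by rewrite ler_pXn2r ?nnegrE ?mulr_ge0 ?(ltW D0)// QD.
  rewrite exprMn ler_wpM2l ?exprn_ge0 ?(ltW D0)//.
  by rewrite mulrAC ler_pdivlMr// mulrC JJ.
rewrite -(ler_pM2r (exprn_gt0 2 c0)) -(ler_pM2r un).
have -> : `|u| ^+ 2 * c ^+ 2 * `|u| ^+ 2 = (c * `|u| ^+ 2) ^+ 2 by ring.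
apply: le_trans cu2 (le_trans cs (le_trans (ler_wpM2l uu0 QJ) _)).
by rewrite le_eqVlt; apply/orP; left; apply/eqP; field; rewrite gt_eqF.
Qed.

End Complement.
End NegativeFamilies.

(** * Isometric relations *)

Section IsometricRelation.
Context {K : numClosedFieldType} {X H : pontryaginType K}.
Variable G : set (X * H).
Hypothesis sG : Defs.subspace G.
Hypothesis isoG : forall p q, G p -> G q -> '[p.2, q.2] = '[p.1, q.1].
Hypothesis ranG : closure [set h | exists x, G (x, h)] = setT.

(** A pair in G orthogonal to a maximal family but with negative square could
be normalized and added to the family. *)
Lemma relation_maximal_negative : exists m (n : 'I_m -> X * H),
  [/\ forall i, G (n i), negative_orthonormal (snd \o n) &
      forall p, G p -> (forall i, '[p.2, (n i).2] = 0) -> 0 <= '[p.2, p.2]].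
Proof.
pose P m := exists n : 'I_m -> X * H,
  (forall i, G (n i)) /\ negative_orthonormal (snd \o n).
have P0 : exists m, `[< P m >].
  by exists 0%N; apply/asboolP; exists (fun=> 0); split=> [[]|[]].
have [k kH] := @negative_orthonormal_bounded K H.
have Pk m : `[< P m >] -> (m <= k)%N by move=> /asboolP[n [_ /kH]].
case: (ex_maxnP P0 Pk) => m /asboolP[n [Gn nn]] mmax.
exists m, n; split=> // p Gp pn.
rewrite real_leNgt ?real0 ?herm_real//; apply/negP => pneg.
pose t := sqrtC (- '[p.2, p.2]).
have t0 : 0 < t by rewrite sqrtC_gt0 oppr_gt0.
have tC : (t^-1)^* = t^-1 by apply/CrealP; rewrite realV gtr0_real.
pose n' (i : 'I_m.+1) := match unlift ord_max i with Some j => n j | None => t^-1 *: p end.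
suff /mmax : `[< P m.+1 >] by rewrite ltnn.
apply/asboolP; exists n'; split=> [i|i j].
  by rewrite /n'; case: unliftP => // _; exact: subspaceZ.
rewrite /n' /=; case: unliftP => [i' ->|->]; case: unliftP => [j' ->|->].
- by rewrite (nn i' j') (inj_eq lift_inj).
- by rewrite /= hermZr herm_orthC// mulr0 eq_sym (negbTE (neq_lift _ _)) oppr0.
- by rewrite /= hermZl pn mulr0 (negbTE (neq_lift _ _)) oppr0.
- have pE : '[p.2, p.2] = - t ^+ 2 by rewrite sqrtCK opprK.
  rewrite /= hermZl hermZr tC eqxx mulrA -expr2 pE mulrN -exprMn mulVf ?gt_eqF//.
  by rewrite expr1n.
Qed.

(** The family splits (x, h) into a component along the family, bounded because
its coefficients <h, h_i> = <x, x_i> are, and the pair (Q1 x, Q h) of G, where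
the form dominates |Q h|^2 on the side of H and is bounded on the side of X. *)
Lemma isometric_relation_bounded :
  exists C : K, 0 < C /\ forall x h, G (x, h) -> `|h| <= C * `|x|.
Proof.
have [m [n [Gn nn npos]]] := relation_maximal_negative.
pose Q := neg_complement (snd \o n); pose Q1 := neg_complement (fst \o n).
have QG x h : G (x, h) -> G (Q1 x, Q h).
  move=> Gxh; have -> : (Q1 x, Q h) = (x, h) + \sum_i '[x, (n i).1] *: n i.
    apply/pair_equal_spec; rewrite /= (raddf_sum (@fst X H)) (raddf_sum (@snd X H)) /=.
    split=> //; congr (_ + _); apply: eq_bigr => i _ /=.
    by rewrite (isoG Gxh (Gn i)).
  apply: subspaceD => //; apply: subspace_sum => // i; exact: subspaceZ.
have [h [x Gxh]|C [C0 QC]] := neg_complement_positive nn ranG.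
  by apply: (npos _ (QG _ _ Gxh)) => i; exact: (neg_complement_orth nn).
have [C1 [C10 ipC1]] := @ip_bounded K X.
have [C2 [C20 Q1C2]] := neg_complement_bounded (fst \o n).
pose D := C * (C1 * C2 ^+ 2).
have D0 : 0 < D by rewrite !mulr_gt0.
exists (D + 1 + \sum_i C1 * (`|(n i).1| * `|(n i).2|)); split.
  apply: ltr_wpDr; last by rewrite addr_gt0.
  by apply: sumr_ge0 => i _; rewrite mulr_ge0 ?mulr_ge0 ?(ltW C10).
move=> x h Gxh.
have Qh : `|Q h| <= (D + 1) * `|x|.
  rewrite -(@ler_pXn2r _ 2)// ?nnegrE ?mulr_ge0 ?addr_ge0 ?(ltW D0)//.
  apply: (@le_trans _ _ (D * `|x| ^+ 2)).
    apply: le_trans (QC h) _; rewrite -mulrA ler_wpM2l ?(ltW C0)//.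
    rewrite -[neg_complement _ h]/(Q1 x, Q h).2 (isoG (QG _ _ Gxh) (QG _ _ Gxh)) /=.
    apply: le_trans (real_ler_norm (herm_real _ _)) _; apply: le_trans (ipC1 _ _) _.
    rewrite -mulrA ler_wpM2l ?(ltW C10)// -exprMn -expr2.
    by rewrite ler_pXn2r ?nnegrE ?mulr_ge0 ?(ltW C20).
  rewrite exprMn ler_wpM2r ?exprn_ge0//.
  rewrite -subr_ge0 (_ : _ - D = D ^+ 2 + D + 1); last by ring.
  by rewrite !addr_ge0 ?exprn_ge0 ?(ltW D0).
have -> : h = Q h - \sum_i '[x, (n i).1] *: (n i).2.
  rewrite /Q /neg_complement -addrA (_ : _ - _ = 0) ?addr0//.
  apply/eqP; rewrite subr_eq0; apply/eqP; apply: eq_bigr => i _ /=.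
  by rewrite (isoG Gxh (Gn i)).
rewrite [leRHS]mulrDl; apply: le_trans (ler_normB _ _) _; apply: lerD => //.
rewrite mulr_suml; apply: le_trans (ler_norm_sum _ _ _) _; apply: ler_sum => i _.
rewrite normrZ.
have -> : C1 * (`|(n i).1| * `|(n i).2|) * `|x| =
  C1 * (`|x| * `|(n i).1|) * `|(n i).2| by ring.
by rewrite ler_wpM2r.
Qed.

Lemma isometric_relation_total : closure [set x | exists h, G (x, h)] = setT ->
  forall x, exists h, closure G (x, h).
Proof.
have [C [C0 GC]] := isometric_relation_bounded => domG x.
exact: bounded_relation_total C0 sG GC domG x.
Qed.

End IsometricRelation.

Lemma closure_relation_ip (K : numClosedFieldType) (X H : pontryaginType K)
    (G : set (X * H)) (q : X * H) :
  (forall p, G p -> '[p.2, q.2] = '[p.1, q.1]) ->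
  forall p, closure G p -> '[p.2, q.2] = '[p.1, q.1].
Proof.
move=> Gq; apply: (closure_equalizer (M := G)) => // p.
  apply: (@continuous_comp _ H K^o snd (fun y => '[y, q.2])).
    exact: cvg_snd.
  exact: ip_continuousl.
apply: (@continuous_comp _ X K^o fst (fun y => '[y, q.1])).
  exact: cvg_fst.
exact: ip_continuousl.
Qed.

Lemma ip_match_subspace (K : numClosedFieldType) (X H : pontryaginType K) (q : X * H) :
  Defs.subspace [set p : X * H | '[p.2, q.2] = '[p.1, q.1]].
Proof.
apply/subspaceP; split=> [|a x y /= Ex Ey]; first by rewrite /= !herm0l.
by rewrite !hermDl !hermZl Ex Ey.
Qed.

Section Gram.
Context {R : realType}.
Local Notation K := (complex_field R).

Definition total_family (X : pontryaginType K) (I : Type) (x : I -> X) : Prop :=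
  forall y, (forall i, '[y, x i] = 0) -> y = 0.

(** The vector g is a limit of combinations of the h i whose counterparts, with
the same coefficients, tend to y. The last clause, for a second matched
pair (y', g'), makes the resulting map isometric. *)
Lemma gram_extension (X H : pontryaginType K) (I : Type) (x : I -> X) (h : I -> H) :
  (forall i j, '[h i, h j] = '[x i, x j]) ->
  total_family x -> total_family h ->
  forall y, exists g, (forall i, '[g, h i] = '[y, x i]) /\
    forall y' g', (forall i, '[g', h i] = '[y', x i]) -> '[g, g'] = '[y, y'].
Proof.
move=> gram xT hT.
pose F := [set p | exists i, p = (x i, h i)]; pose G := lin_span F.
have sG : Defs.subspace G by exact: lin_span_subspace.
have GF i : G (x i, h i) by apply: sub_lin_span; exists i.
have match_all q : (forall i, '[h i, q.2] = '[x i, q.1]) ->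
    forall p, G p -> '[p.2, q.2] = '[p.1, q.1].
  move=> Fq p; move: p; apply: lin_span_sub; first exact: ip_match_subspace.
  by move=> _ [i ->]; exact: Fq.
have isoG p q : G p -> G q -> '[p.2, q.2] = '[p.1, q.1].
  move=> Gp Gq; apply: (match_all q _ p Gp) => i; rewrite herm_conj [RHS]herm_conj.
  by congr _^*; apply: (match_all (x i, h i) _ _ Gq) => j; exact: gram.
have ranG : closure [set g | exists y, G (y, g)] = setT.
  apply: dense_of_orthogonal => [|g gM].
    exact: subspace_ran.
  by apply: hT => i; apply: herm_orthC; apply: gM; exists (x i); exact: GF.
have domG : closure [set y | exists g, G (y, g)] = setT.
  apply: dense_of_orthogonal => [|y yM].
    exact: subspace_dom.
  by apply: xT => i; apply: herm_orthC; apply: yM; exists (h i); exact: GF.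
move=> y; have [g Gyg] := isometric_relation_total sG isoG ranG domG y.
exists g; split=> [i|y' g' yg'].
  apply: (@closure_relation_ip _ _ _ G (x i, h i) _ (y, g) Gyg) => p Gp.
  exact: isoG Gp (GF i).
apply: (@closure_relation_ip _ _ _ G (y', g') _ (y, g) Gyg).
by apply: match_all => i; rewrite herm_conj [RHS]herm_conj yg'.
Qed.

(** The extension in one direction is the map; surjectivity is the extension in
the other direction. *)
Lemma gram_unitary (X H : pontryaginType K) (I : Type) (x : I -> X) (h : I -> H) :
  (forall i j, '[h i, h j] = '[x i, x j]) ->
  total_family x -> total_family h ->
  exists V : X -> H, [/\ forall y i, '[V y, h i] = '[y, x i],
    forall y z, '[V y, V z] = '[y, z] & forall g, exists y, V y = g].
Proof.
move=> gram xT hT; have /choice[V VE] := gram_extension gram xT hT.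
exists V; split=> [y|y z|g]; first exact: (VE y).1.
  by apply: (VE y).2; exact: (VE z).1.
have [y [yE _]] := gram_extension (fun i j => esym (gram i j)) hT xT g.
exists y; apply/eqP; rewrite -subr_eq0; apply/eqP/hT => i.
by rewrite hermBl (VE y).1 yE subrr.
Qed.

End Gram.

Section Isometry.
Context {K : numClosedFieldType} {X H : pontryaginType K} (V : X -> H).
Hypothesis iso : forall x y, '[V x, V y] = '[x, y].

Lemma isometry_inj : injective V.
Proof. by move=> x y xy; apply: ip_inj => z; rewrite -!iso xy. Qed.

(** V (a x + y) - (a V x + V y) is orthogonal to every V z, that is, to all
of H. *)
Lemma isometry_onto_linear : (forall h, exists x, V x = h) -> linear V.
Proof.
move=> onto a x y; apply: ip_injl => h; have [z <-] := onto h.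
by rewrite hermDl hermZl !iso hermDl hermZl.
Qed.

End Isometry.

(** * Resolvents and observability *)

Lemma eq_near0P (K : numClosedFieldType) (T : Type) (f g : K -> T) :
  eq_near0 f g <-> exists2 r : K, 0 < r & forall z, `|z| < r -> f z = g z.
Proof.
split=> [/nbhs_normP[r /= r0 rP]|[r r0 rP]].
  by exists r => // z zr; apply: rP; rewrite /= sub0r normrN.
by apply/nbhs_normP; exists r => // z /=; rewrite sub0r normrN; exact: rP.
Qed.

Lemma eq_near0_trans (K : numClosedFieldType) (T : Type) (f g h : K -> T) :
  eq_near0 f g -> eq_near0 g h -> eq_near0 f h.
Proof. by apply: filterS2 => z -> ->. Qed.

Lemma eq_near0_sym (K : numClosedFieldType) (T : Type) (f g : K -> T) :
  eq_near0 f g -> eq_near0 g f.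
Proof. by apply: filterS => z ->. Qed.

(** The archimedean property of R, for nonnegative elements of R[i]. *)
Lemma natural_multiples_bounded (R : realType) (a b : R[i]) : 0 <= a ->
  (forall n, a * n%:R <= b) -> a = 0.
Proof.
move=> a0 ab; apply/eqP; apply: contraT => an0.
have {an0 a0} : 0 < a by rewrite lt_def an0.
rewrite ltcE /= => /andP[/eqP ima rea].
have b0 := ab 0%N; rewrite mulr0 lecE /= in b0.
have [n nb] : exists n : nat, complex.Re b / complex.Re a < n%:R.
  exists (Num.bound `|complex.Re b / complex.Re a|).
  exact: le_lt_trans (ler_norm _) (archi_boundP (normr_ge0 _)).
have := ab n; rewrite mulr_natr lecE => /andP[_].
have -> : complex.Re (a *+ n) = complex.Re a *+ n.
  by elim: n {nb} => // n IH; rewrite !mulrSr -IH; case: (a) (a *+ n) => ? ? [].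
by rewrite ltr_pdivrMr// mulrC mulr_natr in nb; rewrite leNgt nb.
Qed.

Section Resolvent.
Context {R : realType}.
Local Notation K := (complex_field R).

(** The disc |z| < r lies in the domain of the resolvent, with D a uniform bound
of (I - zA)^-1; injectivity of I - zA is part of the last clause. *)
Definition resolvent_disc (U Y : hilbertType K) k (Sigma : system U Y k) (r D : K) :=
  [/\ 0 < r, 0 < D,
      forall z x, `|z| < r ->
        resolvent (Sigma := Sigma) z x - z *: main_op Sigma (resolvent z x) = x &
      forall z x, `|z| < r -> `|x| <= D * `|x - z *: main_op Sigma x|].

(** For small z the operator I - zA is bounded below, so its range is closed.
The range is also dense: if x is orthogonal to it, then
c |x|^2 <= <x, J x> = conj (z <A J x, x>), which for small z forces x = 0. *)
Lemma neumann_surjective (X : pontryaginType K) (A : 'L(X, X)) :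
  exists r : K, 0 < r /\ forall z, `|z| < r ->
    (forall x, `|x| <= 2 * `|x - z *: A x|) /\
    (forall y, exists x, x - z *: A x = y).
Proof.
have [a [a0 Aa]] := linear_bounded (cl_linear A) (@cl_continuous _ _ _ A).
have [J [j [c [d [jE ipE c0 d0 cd]]]]] := @fundamental_symmetry K X.
have [C [C0 ipC]] := @ip_bounded K X.
have JJ x : c * `|J x| ^+ 2 <= d * `|x| ^+ 2.
  have /andP[+ _] := cd (J x); move=> /le_trans; apply.
  by rewrite (fundamental_symmetry_norm jE ipE); have /andP[] := cd x.
(* The first bound on r1 gives the lower bound 1/2 of I - zA, the second one
   the density of the range. *)
have [r1 [r10 r1a r1c]] : exists e : K,
    [/\ 0 < e, e <= (a *+ 2)^-1 & e <= c ^+ 3 / (d * (C * a) ^+ 2)].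
  apply: pos_min; rewrite ?invr_gt0 ?pmulrn_lgt0// divr_gt0 ?exprn_gt0//.
  by rewrite mulr_gt0 ?exprn_gt0 ?mulr_gt0.
have [r [r0 rr1 rle1]] := pos_min r10 (@ltr01 K).
exists r; split=> // z zr.
have za : `|z| * a <= 2^-1.
  have : `|z| <= (a *+ 2)^-1 by apply: le_trans (ltW zr) (le_trans rr1 r1a).
  rewrite -(ler_pM2r a0) => /le_trans; apply.
  by rewrite le_eqVlt; apply/orP; left; apply/eqP; rewrite -mulr_natr; field; rewrite gt_eqF.
have bnd x : `|x| <= 2 * `|x - z *: A x|.
  have : `|x| <= `|x - z *: A x| + 2^-1 * `|x|.
    rewrite -{1}(subrK (z *: A x) x); apply: le_trans (ler_normD _ _) _.
    rewrite lerD2l normrZ; apply: le_trans (ler_wpM2l _ (Aa x)) _ => //.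
    by rewrite mulrA ler_wpM2r.
  rewrite -lerBlDr -{1}[`|x|]mul1r -mulrBl.
  have -> : 1 - 2^-1 = 2^-1 :> K by field.
  by rewrite mulrC ler_pdivrMr// mulrC.
split=> // y.
pose T x := x - z *: A x.
have lT : linear T.
  by move=> b u v; rewrite /T (cl_linear A) scalerDr opprD addrACA scalerBr !scalerA (mulrC z).
pose G := [set p : X * X | p.1 = T p.2].
have sG : Defs.subspace G.
  apply/subspaceP; split; first by rewrite /G /T /= linear0 scaler0 subrr.
  by move=> b [u1 u2] [v1 v2]; rewrite /G /= => -> ->; rewrite lT.
have cT : continuous T.
  apply: (@bounded_continuous _ _ _ _ (1 + `|z| * a)) => // [|x].
    by rewrite ltr_wpDr// mulr_ge0 ?(ltW a0).
  apply: le_trans (ler_normB _ _) _; rewrite mulrDl mul1r lerD2l normrZ.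
  by rewrite -mulrA ler_wpM2l.
have GT : closure [set d | exists g, G (d, g)] = setT.
  apply: dense_of_orthogonal => [|x xM].
    exact: subspace_dom.
  have TJ : '[J x, x] = z * '[A (J x), x].
    have : '[T (J x), x] = 0 by apply: xM; exists (J x).
    by rewrite /T hermBl hermZl => /eqP; rewrite subr_eq0 => /eqP.
  apply/eqP; apply: contraT => x0.
  have xn : 0 < `|x| ^+ 2 by rewrite exprn_gt0// normr_gt0.
  have key : (c * `|x| ^+ 2) ^+ 2 <= (`|z| * (C * a) * (`|J x| * `|x|)) ^+ 2.
    rewrite ler_pXn2r ?nnegrE ?mulr_ge0 ?(ltW c0) ?exprn_ge0 ?(ltW C0) ?(ltW a0)//.
    have /andP[/le_trans h _] := cd x; apply: h.
    apply: le_trans (real_ler_norm (herm_real _ _)) _.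
    rewrite jE herm_conj norm_conjC TJ normrM -!mulrA ler_wpM2l//.
    apply: le_trans (ipC _ _) _; rewrite ler_wpM2l ?(ltW C0)//.
    by rewrite mulrA ler_wpM2r.
  have : c ^+ 3 <= `|z| ^+ 2 * (d * (C * a) ^+ 2).
    rewrite -(ler_pM2r xn) -(ler_pM2r xn).
    have -> : c ^+ 3 * `|x| ^+ 2 * `|x| ^+ 2 = c * (c * `|x| ^+ 2) ^+ 2 by ring.
    apply: le_trans (ler_wpM2l (ltW c0) key) _.
    have -> : c * (`|z| * (C * a) * (`|J x| * `|x|)) ^+ 2 =
      (c * `|J x| ^+ 2) * (`|z| ^+ 2 * (C * a) ^+ 2 * `|x| ^+ 2) by ring.
    have -> : `|z| ^+ 2 * (d * (C * a) ^+ 2) * `|x| ^+ 2 * `|x| ^+ 2 =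
      (d * `|x| ^+ 2) * (`|z| ^+ 2 * (C * a) ^+ 2 * `|x| ^+ 2) by ring.
    by rewrite ler_wpM2r// !mulr_ge0 ?exprn_ge0 ?mulr_ge0 ?(ltW C0) ?(ltW a0).
  rewrite -ler_pdivrMr; last by rewrite mulr_gt0 ?exprn_gt0 ?mulr_gt0.
  move=> /(le_trans r1c) zz.
  have : `|z| ^+ 2 < r1.
    apply: lt_le_trans rr1; apply: (le_lt_trans _ zr).
    by rewrite expr2 ler_piMr// (le_trans (ltW zr) rle1).
  by move=> /(le_lt_trans zz); rewrite ltxx.
have GB u v : G (u, v) -> `|v| <= 2 * `|u| by rewrite /G /= => ->; exact: bnd.
have [x Gyx] := bounded_relation_total (ltr0n K 2) sG GB GT y.
exists x; apply: esym.
apply: (closure_equalizer (M := G) (f := fst) (g := T \o snd)) Gyx => //.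
  by move=> p; exact: cvg_fst.
by move=> p; apply: continuous_comp; [exact: cvg_snd|exact: cT].
Qed.

Lemma resolvent_disc_exists (U Y : hilbertType K) k (Sigma : system U Y k) :
  exists r, resolvent_disc Sigma r 2.
Proof.
have [r [r0 rP]] := neumann_surjective (main_op Sigma).
exists r; split=> // [z x zr|z x /rP[]//].
have [_ /(_ x)] := rP z zr.
exact: (@xgetPex _ 0 [set x' | x' - z *: main_op Sigma x' = x]).
Qed.

End Resolvent.

Section ObservabilityFunction.
Context {R : realType}.
Local Notation K := (complex_field R).
Context {U Y : hilbertType K} {k : nat} (Sigma : system U Y k).
Local Notation A := (main_op Sigma).
Local Notation B := (control_op Sigma).
Local Notation C := (observation_op Sigma).
Local Notation D := (feedthrough_op Sigma).
Local Notation res := (resolvent (Sigma := Sigma)).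

Definition state_output (x : state Sigma) (z : K) : Y := C (res z x).

Section Disc.
Variables (r M : K).
Hypothesis disc : resolvent_disc Sigma r M.

Lemma resolvent_eq z x x' : `|z| < r -> x' - z *: A x' = x -> res z x = x'.
Proof.
have [r0 M0 rP rB] := disc => zr x'x; apply/eqP; rewrite -subr_eq0 -normr_le0.
apply: le_trans (rB z _ zr) _.
have -> : res z x - x' - z *: A (res z x - x') =
    (res z x - z *: A (res z x)) - (x' - z *: A x').
  by rewrite cl_sub scalerBr !opprD opprK addrACA.
by rewrite rP// x'x subrr normr0 mulr0.
Qed.

Lemma resolvent_linear z : `|z| < r -> linear (res z).
Proof.
have [r0 M0 rP rB] := disc => zr a x y; apply: resolvent_eq => //.
rewrite (cl_linear A) scalerDr opprD addrACA !scalerA (mulrC z) -scalerA -scalerBr.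
by rewrite !rP.
Qed.

Lemma resolvent_bounded z x : `|z| < r -> `|res z x| <= M * `|x|.
Proof.
by have [r0 M0 rP rB] := disc => zr; apply: le_trans (rB z _ zr) _; rewrite rP.
Qed.

Lemma resolvent_continuous z : `|z| < r -> continuous (res z).
Proof.
have [r0 M0 rP rB] := disc => zr.
by apply: (bounded_continuous M0 (resolvent_linear zr)) => x; exact: resolvent_bounded.
Qed.

Lemma resolvent0 x : res 0 x = x.
Proof.
have [r0 _ _ _] := disc; apply: resolvent_eq; first by rewrite normr0.
by rewrite scale0r subr0.
Qed.

(** One step of the Neumann series. *)
Lemma resolvent_shift z x : `|z| < r -> res z x = x + z *: res z (A x).
Proof.
have [r0 M0 rP rB] := disc => zr; apply: resolvent_eq => //.
have E : A x + z *: A (res z (A x)) = res z (A x).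
  by rewrite -{1}(rP z (A x) zr) subrK.
by rewrite cl_add cl_scale E addrK.
Qed.

(** The C A^n x are the Taylor coefficients of the function. From left to right
they are split off one at a time, dividing by z and letting z tend to 0; from
right to left the remainder z^n C (I - zA)^-1 A^n x tends to 0. *)
Lemma state_output_eq0 x : eq_near0 (state_output x) (fun=> 0) <->
  forall n, C (iter n A x) = 0.
Proof.
have [r0 M0 rP rB] := disc.
have [a [a0 Aa]] := linear_bounded (cl_linear A) (@cl_continuous _ _ _ A).
have [c [c0 Cc]] := linear_bounded (cl_linear C) (@cl_continuous _ _ _ C).
split=> [x0 n|x0].
  have near_at0 y : eq_near0 (state_output y) (fun=> 0) -> C y = 0.
    by move=> /eq_near0P[e e0 eP]; rewrite -(resolvent0 y); apply: eP; rewrite normr0.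
  suff : eq_near0 (state_output (iter n A x)) (fun=> 0) by exact: near_at0.
  elim: n => // n IH; have Cx0 := near_at0 _ IH.
  rewrite iterS; move: (iter n A x) Cx0 IH => {x0} {}x Cx0 /eq_near0P[e e0 eP].
  have [s [s0 se sr]] := pos_min e0 r0.
  have Cs z : `|z| < s -> z != 0 -> C (res z (A x)) = 0.
    move=> zs z0; have zr := lt_le_trans zs sr.
    have := eP z (lt_le_trans zs se); rewrite /state_output resolvent_shift//.
    rewrite cl_add Cx0 add0r cl_scale => /eqP.
    by rewrite scaler_eq0 (negbTE z0) => /eqP.
  apply/eq_near0P; exists s => // z zs.
  have [->|z0] := eqVneq z 0; last exact: Cs.
  rewrite /state_output resolvent0; apply/eqP; rewrite -normr_eq0; apply/eqP.
  (* The value at 0 is compared with the value 0 at the point t s / 2. *)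
  apply: (@small_eq0 _ _ (c * (M * `|A (A x)|) * s)) => //.
    by rewrite !mulr_ge0 ?(ltW c0) ?(ltW M0) ?(ltW s0).
  move=> t t0 t1; have ts0 : 0 < t * s / 2 by rewrite divr_gt0 ?mulr_gt0.
  have tss : t * s / 2 < s by rewrite ltr_pdivrMr// mulrC ltr_pM2l// (le_lt_trans t1)// ltr1n.
  have tsn : `|t * s / 2| = t * s / 2 by rewrite gtr0_norm.
  have := Cs (t * s / 2); rewrite tsn => /(_ tss); rewrite gt_eqF// => /(_ isT).
  rewrite resolvent_shift ?tsn ?(lt_le_trans tss)// cl_add => /eqP; rewrite addr_eq0 => /eqP ->.
  rewrite normrN; apply: le_trans (Cc _) _; rewrite normrZ tsn.
  apply: (@le_trans _ _ (c * (t * s * (M * `|A (A x)|)))).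
    rewrite ler_wpM2l ?(ltW c0)//; apply: ler_pM => //; first exact: ltW.
      by rewrite ler_pdivrMr// ler_peMr ?mulr_ge0 ?(ltW t0) ?(ltW s0)// ler1n.
    by apply: resolvent_bounded; rewrite tsn (lt_le_trans tss).
  by rewrite le_eqVlt; apply/orP; left; apply/eqP; ring.
have [s [s0 sr sa]] : exists e : K, [/\ 0 < e, e <= r & e <= (a *+ 2)^-1].
  by apply: pos_min => //; rewrite invr_gt0 pmulrn_lgt0.
apply/eq_near0P; exists s => // z zs.
have zr := lt_le_trans zs sr.
have za : `|z| * a <= 2^-1.
  rewrite -ler_pdivlMr// -invfM mulrC mulr_natr; exact: le_trans (ltW zs) sa.
have resE n : C (res z x) = z ^+ n *: C (res z (iter n A x)).
  elim: n => [|n IH]; first by rewrite expr0 scale1r.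
  by rewrite IH resolvent_shift// cl_add x0 add0r cl_scale scalerA exprSr.
have An n : `|iter n A x| <= a ^+ n * `|x|.
  elim: n => [|n IH]; first by rewrite expr0 mul1r.
  rewrite iterS; apply: le_trans (Aa _) _.
  by rewrite exprS -mulrA ler_wpM2l ?(ltW a0).
apply/eqP; rewrite -normr_eq0; apply/eqP.
apply: (@natural_multiples_bounded _ _ (c * (M * `|x|))) => // n.
apply: (@le_trans _ _ (`|state_output x z| * 2 ^+ n)).
  by rewrite ler_wpM2l// -natrX ler_nat ltnW// ltn_expl.
rewrite /state_output (resE n) normrZ normrX -ler_pdivlMr ?exprn_gt0//.
apply: (@le_trans _ _ (`|z| ^+ n * (c * (M * (a ^+ n * `|x|))))).
  rewrite ler_wpM2l ?exprn_ge0//; apply: le_trans (Cc _) _; rewrite ler_wpM2l ?(ltW c0)//.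
  by apply: le_trans (resolvent_bounded _ zr) _; rewrite ler_wpM2l ?(ltW M0).
have -> : `|z| ^+ n * (c * (M * (a ^+ n * `|x|))) = (`|z| * a) ^+ n * (c * (M * `|x|)).
  by rewrite exprMn; ring.
rewrite mulrC ler_wpM2l ?mulr_ge0 ?(ltW c0) ?(ltW M0)// -exprVn.
by rewrite lerXn2r ?nnegrE ?mulr_ge0 ?(ltW a0) ?invr_ge0.
Qed.

End Disc.

(** The defining vectors A*^n C* f of observability test exactly the Taylor
coefficients C A^n x, since <C A^n x, f> = <x, A*^n C* f>. *)
Lemma observableP : observable Sigma <->
  forall x, eq_near0 (state_output x) (fun=> 0) -> x = 0.
Proof.
have [r disc] := resolvent_disc_exists Sigma.
have adjA := adjP (cl_linear A) (@cl_continuous _ _ _ A).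
have adjC := adjP (cl_linear C) (@cl_continuous _ _ _ C).
have iterA n y x : '[C (iter n A x), y] = '[x, iter n (adj A) (adj C y)].
  by rewrite adjC; elim: n x => // n IH x; rewrite iterSr IH adjA.
split=> [obs x /(state_output_eq0 disc) x0|sep].
  apply: ip_nondegenerate => y.
  have : closure (lin_span [set x | exists n y, x = iter n (adj A) (adj C y)]) y.
    by rewrite obs.
  apply: (closure_equalizer (f := fun y => '[y, x] : K^o) (g := fun=> 0)).
  - exact: ip_continuousl.
  - exact: cst_continuous.
  apply: lin_span_sub.
    apply/subspaceP; split=> [|b u v /= u0 v0]; first by rewrite /= herm0l.
    by rewrite /= hermDl hermZl u0 v0 mulr0 addr0.
  by move=> _ [n [f ->]] /=; apply: herm_orthC; rewrite -iterA x0 herm0l.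
apply: dense_of_orthogonal => [|x x0]; first exact: lin_span_subspace.
apply: sep; apply/(state_output_eq0 disc) => n; apply: ip_nondegenerate => y.
apply: herm_orthC; rewrite iterA; apply/herm_orthC/x0/sub_lin_span.
by exists n, y.
Qed.

End ObservabilityFunction.

(** * The canonical model of a co-isometric observable system *)

Section ReproducingKernelSpace.
Context {K : numClosedFieldType} {U Y : hilbertType K} {S : K -> 'L(U, Y)}.

Lemma holomorphy_domain_near0 : holomorphic_at S 0 ->
  exists2 r : K, 0 < r & forall z, `|z| < r -> holomorphy_domain S z.
Proof.
move=> /nbhs_normP[r /= r0 rP].
have [s [s0 sr s1]] := pos_min r0 (@ltr01 K).
exists s => // z zs; split; first exact: lt_le_trans s1.
apply/nbhs_normP; exists (s - `|z|) => /=; first by rewrite subr_gt0.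
move=> w /= zw; apply: rP; rewrite /= sub0r normrN.
apply: lt_le_trans sr; rewrite -(subrK z w); apply: le_lt_trans (ler_normD _ _) _.
by rewrite -ltrBrDr distrC.
Qed.

Variable H : rk_space S.

Lemma rk_eval0 z : holomorphy_domain S z -> rk_eval (0 : H) z = 0.
Proof.
by move=> Sz; have := rk_linear Sz (-1) (0 : H) 0; rewrite scaler0 addr0 scaleN1r addNr.
Qed.

Lemma rk_eq0 (r : K) (h : H) : 0 < r ->
  (forall w, `|w| < r -> holomorphy_domain S w) ->
  (forall w f, `|w| < r -> '[rk_eval h w, f] = 0) -> h = 0.
Proof.
move=> r0 dom h0; apply: rk_inj; apply/eq_near0P; exists r => // w wr.
rewrite (rk_eval0 (dom w wr)); apply: ip_injl => f; by rewrite h0// herm0l.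
Qed.

End ReproducingKernelSpace.

Section CanonicalModel.
Context {R : realType}.
Local Notation K := (complex_field R).
Context {U Y : hilbertType K} {k : nat} (Sigma : system U Y k).
Local Notation A := (main_op Sigma).
Local Notation B := (control_op Sigma).
Local Notation C := (observation_op Sigma).
Local Notation D := (feedthrough_op Sigma).
Local Notation res := (resolvent (Sigma := Sigma)).
Local Notation T := (system_operator (Sigma := Sigma)).

Lemma system_operator_linear : linear T.
Proof.
move=> a [x u] [y v]; rewrite /system_operator /= !(cl_add, cl_scale).
by congr (_, _) => /=; rewrite !scalerDr addrACA.
Qed.

Lemma system_operator_continuous : continuous T.
Proof.
move=> p; apply: cvg_pair; apply: cvgD;
  apply: continuous_comp; try exact: cvg_fst; try exact: cvg_snd; exact: cl_continuous.
Qed.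

Variable S : K -> 'L(U, Y).
Variable H : rk_space S.

Lemma adj_cont_linear (z : K) u y : '[S z u, y] = '[u, adj (S z) y].
Proof. exact: adjP (cl_linear (S z)) (@cl_continuous _ _ _ (S z)) _ _. Qed.

(** The hypothesis on x says that x = (I - conj w A* )^-1 C* f. Then the adjoint
of the system operator maps (conj w x, f) to (x, S(w)* f), so co-isometry gives
A x + B S(w)* f = conj w x and C x + D S(w)* f = f. Eliminating S(w)* f between
these equations expresses C (I - zA)^-1 x through S(z) S(w)* f. *)
Lemma coisometric_kernel (r M w z : K) (f : Y) (x : state Sigma) :
  coisometric Sigma -> resolvent_disc Sigma r M -> r <= 1 ->
  (forall v, `|v| < r -> transfer_function Sigma v =1 S v) ->
  `|w| < r -> `|z| < r ->
  (forall y, '[state_output y w, f] = '[y, x]) ->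
  state_output x z = schur_kernel S w z f.
Proof.
move=> coT disc r1 SE wr zr kx.
have adjT : adj T (w^* *: x, f) = (x, adj (S w) f).
  apply: adj_eq => -[y u]; rewrite /ip /= /prod_ip /= !hermDl !hermZr conjCK.
  rewrite -adj_cont_linear -SE// /transfer_function hermDl hermZl.
  rewrite -[C (res w (B u))]/(state_output (B u) w) kx -(kx y).
  rewrite /state_output (resolvent_shift disc y wr) cl_add cl_scale hermDl hermZl.
  by rewrite -[C (res w (A y))]/(state_output (A y) w) kx; ring.
have := coT (w^* *: x, f); rewrite adjT => -[/= Ax Cx].
(* The bound r <= 1 keeps the denominator of the kernel away from 0. *)
have zw : 1 - z * w^* != 0.
  have zw1 : `|z * w^*| < 1.
    rewrite normrM norm_conjC; apply: mulr_ilt1 => //; exact: lt_le_trans r1.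
  by apply: contraTneq zw1 => /eqP; rewrite subr_eq0 => /eqP <-; rewrite normr1 ltxx.
have xE : x = (1 - z * w^*) *: res z x + z *: res z (B (adj (S w) f)).
  have lr := resolvent_linear disc zr.
  rewrite -(linear_scale lr z) -lr; apply: esym; apply: (resolvent_eq disc) => //.
  have -> : A x = w^* *: x - B (adj (S w) f) by rewrite -Ax addrK.
  by rewrite scalerBr scalerA opprB addrCA addrC scalerBl scale1r.
apply: (scalerI zw); rewrite /schur_kernel scalerA mulfV// scale1r.
rewrite -SE// /transfer_function -{1}Cx {2}xE cl_add !cl_scale.
by rewrite (addrC (D _)) opprD addrACA addrK subrr addr0.
Qed.

(** The families k(w,f) in the state space and K_S(w,.)f in H(S), for w in a
disc where everything is defined, have equal Gram matrices and only 0 is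
orthogonal to either of them. *)
Lemma canonical_model :
  coisometric Sigma -> observable Sigma -> realizes Sigma S -> holomorphic_at S 0 ->
  exists V : state Sigma -> H,
    [/\ forall x, eq_near0 (rk_eval (V x)) (state_output x),
        forall x y, '[V x, V y] = '[x, y] & forall h, exists x, V x = h].
Proof.
move=> coT /observableP obs /eq_near0P[r1 r10 SE] /holomorphy_domain_near0[r2 r20 dom].
have [r3 disc3] := resolvent_disc_exists Sigma.
have [r30 _ _ _] := disc3.
have [r12 [r120 rr1 rr2]] := pos_min r10 r20.
have [r13 [r130 rr13 rr3]] := pos_min r120 r30.
have [r [r0 rr rle1]] := pos_min r130 (@ltr01 K).
have {}SE z : `|z| < r -> transfer_function Sigma z =1 S z.
  by move=> zr u; rewrite SE// (lt_le_trans zr)// (le_trans rr)// (le_trans rr13).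
have {}dom z : `|z| < r -> holomorphy_domain S z.
  by move=> zr; apply: dom; rewrite (lt_le_trans zr)// (le_trans rr)// (le_trans rr13).
have disc : resolvent_disc Sigma r 2.
  have [_ m0 m1 m2] := disc3; have rr3' := le_trans rr rr3.
  by split=> // z x zr; [apply: m1|apply: m2]; exact: lt_le_trans rr3'.
pose I := {p : K * Y | `|p.1| < r}.
have /choice[x xE] (i : I) : exists x : state Sigma,
    forall y, '[state_output y (val i).1, (val i).2] = '[y, x].
  case: i => -[w f] /= wr; apply: riesz.
    move=> a u v; rewrite /state_output (resolvent_linear disc wr) cl_add cl_scale.
    by rewrite hermDl hermZl.
  move=> u; apply: (@continuous_comp _ Y K^o (fun u => state_output u w) (fun y => '[y, f])).
    apply: (@continuous_comp _ _ Y (res w) C); last exact: cl_continuous.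
    exact: (@resolvent_continuous _ _ _ _ _ _ _ disc _ wr u).
  exact: ip_continuousl.
have /choice[h hE] (i : I) : exists h : H,
    (forall z, holomorphy_domain S z -> rk_eval h z = schur_kernel S (val i).1 z (val i).2) /\
    (forall g, '[g, h] = '[rk_eval g (val i).1, (val i).2]).
  by apply: rk_kernel; apply: dom; exact: (valP i).
have gram i j : '[h i, h j] = '[x i, x j].
  have jr := valP j.
  rewrite (hE j).2 (hE i).1; last exact: dom.
  by rewrite -xE -(coisometric_kernel coT disc rle1 SE (valP i) jr (xE i)).
have xtot : total_family x.
  move=> y y0; apply: obs; apply/eq_near0P; exists r => // w wr; apply: ip_injl => f.
  by rewrite /= herm0l -(y0 (exist _ (w, f) wr)) -xE.
have htot : total_family h.
  move=> g g0; apply: (rk_eq0 r0 dom) => w f wr.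
  by have := (hE (exist _ (w, f) wr)).2 g; rewrite g0.
have [V [VE Viso Vsurj]] := gram_unitary gram xtot htot.
exists V; split=> // y; apply/eq_near0P; exists r => // w wr; apply: ip_injl => f.
by have := VE y (exist _ (w, f) wr); rewrite (hE _).2 -xE.
Qed.

End CanonicalModel.

(** * Products of systems and of operator functions *)

Lemma prod_ipE (K : numClosedFieldType) (V W : pontryaginType K) (p q : V * W) :
  '[p, q] = '[p.1, q.1] + '[p.2, q.2].
Proof. by []. Qed.

Section Product.
Context {R : realType}.
Local Notation K := (complex_field R).
Context {U Y1 Y : hilbertType K} {k1 k2 : nat}.
Variables (Sigma2 : system Y1 Y k2) (Sigma1 : system U Y1 k1).
Local Notation Sigma := (product_system Sigma2 Sigma1).

(** If the adjoint of T2 maps (b, y) to (b', y1') and the adjoint of T1 maps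
(a, y1') to (a', u'), then the adjoint of the product maps (a, b, y) to
(a', b', u'), and T1, T2 lead back in the opposite order. *)
Lemma product_coisometric :
  coisometric Sigma1 -> coisometric Sigma2 -> coisometric Sigma.
Proof.
move=> co1 co2 [[a b] y].
case E2 : (adj (system_operator (Sigma := Sigma2)) (b, y)) => [b' y1'].
case E1 : (adj (system_operator (Sigma := Sigma1)) (a, y1')) => [a' u'].
have T2 := co2 (b, y); rewrite E2 in T2.
have T1 := co1 (a, y1'); rewrite E1 in T1.
have adj1 := adjP (@system_operator_linear _ _ _ _ Sigma1)
  (@system_operator_continuous _ _ _ _ Sigma1).
have adj2 := adjP (@system_operator_linear _ _ _ _ Sigma2)
  (@system_operator_continuous _ _ _ _ Sigma2).
have -> : adj (system_operator (Sigma := Sigma)) ((a, b), y) = ((a', b'), u').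
  apply: adj_eq => -[[x1 x2] u].
  pose v := observation_op Sigma1 x1 + feedthrough_op Sigma1 u.
  have := adj2 (x2, v) (b, y); have := adj1 (x1, u) (a, y1').
  rewrite E1 E2 !prod_ipE /= => e1 e2.
  rewrite /ip /= /prod_ip /= /prod_ip /= /prod_observation /prod_feedthrough /=.
  rewrite -/v in e1.
  have -> : control_op Sigma2 (observation_op Sigma1 x1) + main_op Sigma2 x2 +
      control_op Sigma2 (feedthrough_op Sigma1 u) = main_op Sigma2 x2 + control_op Sigma2 v.
    by rewrite /v cl_add addrAC addrC.
  have -> : feedthrough_op Sigma2 (observation_op Sigma1 x1) + observation_op Sigma2 x2 +
      feedthrough_op Sigma2 (feedthrough_op Sigma1 u) =
      observation_op Sigma2 x2 + feedthrough_op Sigma2 v.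
    by rewrite /v cl_add addrAC addrC.
  by rewrite -addrA e2 addrCA e1 addrCA addrA.
move: T1 T2; rewrite /system_operator /= => -[T1 T1'] [T2 T2'].
rewrite /prod_main /prod_control /prod_observation /prod_feedthrough /=.
congr (_, _); first congr (_, _) => //=.
- by rewrite addrAC -cl_add T1' addrC.
- by rewrite addrAC -cl_add T1' addrC.
Qed.

(** The main operator of the product is lower triangular, so its resolvent
maps (x1, x2) to (a, R2 (x2 + z B2 C1 a)) with a = R1 x1, where R1 and R2 are
the resolvents of the factors. *)
Lemma product_state_output : exists2 r : K, 0 < r & forall z, `|z| < r -> forall x1 x2,
  state_output (Sigma := Sigma) (x1, x2) z =
  transfer_function Sigma2 z (state_output x1 z) + state_output x2 z.
Proof.
have [r1 disc1] := resolvent_disc_exists Sigma1.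
have [r2 disc2] := resolvent_disc_exists Sigma2.
have [r disc] := resolvent_disc_exists Sigma.
have [[r10 _ P1 _] [r20 _ P2 _] [r0 _ _ _]] := And3 disc1 disc2 disc.
have [s' [s'0 s1 s2]] := pos_min r10 r20; have [s [s0 ss' sr]] := pos_min s'0 r0.
exists s => // z zs x1 x2.
have zs' := lt_le_trans zs ss'; have z1 := lt_le_trans zs' s1; have z2 := lt_le_trans zs' s2.
pose a := resolvent (Sigma := Sigma1) z x1.
pose w := control_op Sigma2 (observation_op Sigma1 a).
pose b := resolvent (Sigma := Sigma2) z (x2 + z *: w).
have ab : resolvent (Sigma := Sigma) z (x1, x2) = (a, b).
  apply: (resolvent_eq disc); first exact: lt_le_trans zs sr.
  congr (_, _); first exact: P1.
  rewrite /= -/w scalerDr opprD addrA addrAC.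
  by rewrite (P2 z (x2 + z *: w) z2) addrK.
rewrite /state_output ab /= /prod_observation /=.
rewrite /transfer_function -addrA; congr (_ + _).
by rewrite /b (addrC x2) (resolvent_linear disc2 z2) cl_add cl_scale.
Qed.

(** The formula for states, applied to the control vector (B1 u, B2 D1 u). *)
Lemma product_transfer_function : exists2 r : K, 0 < r & forall z, `|z| < r ->
  forall u, transfer_function Sigma z u = transfer_function Sigma2 z (transfer_function Sigma1 z u).
Proof.
have [r r0 rP] := product_state_output.
have [r2 disc2] := resolvent_disc_exists Sigma2; have [r20 _ _ _] := disc2.
have [s [s0 sr s2]] := pos_min r0 r20.
exists s => // z zs u.
have := rP z (lt_le_trans zs sr) (control_op Sigma1 u)
  (control_op Sigma2 (feedthrough_op Sigma1 u)).
rewrite {1}/state_output => E.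
rewrite [LHS]/transfer_function /= /prod_feedthrough /=.
rewrite [X in z *: X]E /transfer_function !cl_add !cl_scale.
have lr := resolvent_linear disc2 (lt_le_trans zs s2).
rewrite (addrC (control_op Sigma2 (feedthrough_op Sigma1 u))) lr cl_add cl_scale.
by rewrite !scalerDr !addrA.
Qed.

End Product.

(** The product rule. With a = S1(z) u and a' = S1(h + z) u, the error term is
the sum of the error of S2 at a', of L2 (a' - a), and of S2(z) applied to the
error of S1; each is made at most e/3 |u|. *)
Lemma op_derivable_comp (K : numClosedFieldType) (U Y1 Y : hilbertType K)
    (S1 : K -> 'L(U, Y1)) (S2 : K -> 'L(Y1, Y)) (S : K -> 'L(U, Y)) (z : K) :
  op_derivable S1 z -> op_derivable S2 z ->
  (\forall w \near z, S w =1 S2 w \o S1 w) -> op_derivable S z.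
Proof.
move=> [L1 d1] [L2 d2] SE.
pose L u := L2 (S1 z u) + S2 z (L1 u).
have lL : linear L.
  by move=> a u v; rewrite /L !(cl_add, cl_scale) scalerDr addrACA.
have cL : continuous L.
  move=> u; apply: cvgD; apply: continuous_comp; exact: cl_continuous.
exists (ContLinear lL cL) => e e0.
have bd (V W : normedModType K) (T : 'L(V, W)) :
    exists C : K, 0 < C /\ forall x, `|T x| <= C * `|x|.
  exact: linear_bounded (cl_linear T) (@cl_continuous _ _ _ T).
have [l1 [l10 L1b]] := bd _ _ L1; have [l2 [l20 L2b]] := bd _ _ L2.
have [s1 [s10 S1b]] := bd _ _ (S1 z); have [s2 [s20 S2b]] := bd _ _ (S2 z).
pose e1 := e / 3 / s2; pose e2 := e / 3 / (s1 + 1).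
have e10 : 0 < e1 by rewrite !divr_gt0.
have e20 : 0 < e2 by rewrite !divr_gt0// addr_gt0.
pose g := e1 + l1.
have g0 : 0 < g by rewrite addr_gt0.
have [t [t0 t1 te]] : exists t : K, [/\ 0 < t, t <= g^-1 & t <= e / 3 / l2 / g].
  by apply: pos_min; rewrite ?invr_gt0// !divr_gt0.
have SEz := nbhs_singleton SE.
have SEh : \forall h \near (0 : K)^', S (h + z) =1 S2 (h + z) \o S1 (h + z).
  move: SE => /nbhs_normP[r /= r0 rP]; apply: nbhs_dnbhs; apply/nbhs_normP.
  exists r => // h /=; rewrite sub0r normrN => hr; apply: rP => /=.
  by rewrite opprD addrCA subrr addr0 normrN.
near=> h => u.
have h0 : h != 0 by near: h; exact: nbhs_dnbhs_neq.
have ht : `|h| <= t by near: h; exact: dnbhs0_le.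
have E1 : forall u, `|h^-1 *: (S1 (h + z) u - S1 z u) - L1 u| <= e1 * `|u|.
  by near: h; exact: d1.
have E2 : forall u, `|h^-1 *: (S2 (h + z) u - S2 z u) - L2 u| <= e2 * `|u|.
  by near: h; exact: d2.
have E3 : S (h + z) =1 S2 (h + z) \o S1 (h + z) by near: h; exact: SEh.
rewrite E3 (SEz u) /= /L.
set a' := S1 (h + z) u; set a := S1 z u.
have aa : `|a' - a| <= `|h| * g * `|u|.
  have -> : a' - a = h *: (h^-1 *: (a' - a) - L1 u + L1 u).
    by rewrite subrK scalerA mulfV// scale1r.
  rewrite normrZ -mulrA ler_wpM2l// mulrDl; apply: le_trans (ler_normD _ _) _.
  by rewrite lerD// E1.
have -> : h^-1 *: (S2 (h + z) a' - S2 z a) - (L2 a + S2 z (L1 u)) =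
    (h^-1 *: (S2 (h + z) a' - S2 z a') - L2 a') + L2 (a' - a) +
    S2 z (h^-1 *: (a' - a) - L1 u).
  rewrite !cl_sub cl_scale cl_sub (addrA (_ - L2 a')) subrK addrACA -scalerDr.
  by rewrite (addrA (_ - S2 z a')) subrK -opprD.
have -> : e * `|u| = e / 3 * `|u| + e / 3 * `|u| + e / 3 * `|u|.
  by rewrite -!mulrDl; congr (_ * _); field.
apply: le_trans (ler_normD _ _) _; apply: lerD.
  apply: le_trans (ler_normD _ _) _; apply: lerD.
    apply: le_trans (E2 a') _.
    have -> : e / 3 * `|u| = e2 * ((s1 + 1) * `|u|).
      by rewrite /e2; field; rewrite gt_eqF// addr_gt0.
    rewrite ler_wpM2l ?(ltW e20)// -(subrK a a') addrC mulrDl mul1r.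
    apply: le_trans (ler_normD _ _) _; apply: lerD; first exact: S1b.
    apply: le_trans aa _; rewrite ler_piMl//.
    by rewrite -ler_pdivlMr// mul1r (le_trans ht).
  apply: le_trans (L2b _) _; apply: (@le_trans _ _ (l2 * (`|h| * g * `|u|))).
    by rewrite ler_wpM2l ?(ltW l20).
  rewrite mulrA ler_wpM2r// mulrC -ler_pdivlMr// -ler_pdivlMr//.
  exact: le_trans te.
apply: le_trans (S2b _) _.
have -> : e / 3 * `|u| = s2 * (e1 * `|u|) by rewrite /e1; field; rewrite gt_eqF.
by rewrite ler_wpM2l ?(ltW s20)// E1.
Unshelve. all: end_near. Qed.

Lemma holomorphic_at_comp (K : numClosedFieldType) (U Y1 Y : hilbertType K)
    (S1 : K -> 'L(U, Y1)) (S2 : K -> 'L(Y1, Y)) (S : K -> 'L(U, Y)) :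
  holomorphic_at S1 0 -> holomorphic_at S2 0 ->
  eq_near0 (fun z => S z : U -> Y) (fun z => S2 z \o S1 z) -> holomorphic_at S 0.
Proof.
move=> h1 h2 /nbhs_normP[r /= r0 rP]; rewrite /holomorphic_at.
have near_r : \forall z \near (0 : K), `|z| < r.
  by apply/nbhs_normP; exists r => // z /=; rewrite sub0r normrN.
move: h1 h2 near_r; apply: filterS3 => z d1 d2 zr; apply: op_derivable_comp d1 d2 _.
apply/nbhs_normP; exists (r - `|z|) => /=; first by rewrite subr_gt0.
move=> w /= zw u; rewrite (rP w) //= sub0r normrN -(subrK z w).
apply: le_lt_trans (ler_normD _ _) _.
by rewrite -ltrBrDr distrC.
Qed.

(** * The factorization theorem *)

Section Factorization.
Context {R : realType}.
Local Notation K := (complex_field R).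
Context {U Y1 Y : hilbertType K} {k1 k2 : nat}.
Context {S1 : K -> 'L(U, Y1)} {S2 : K -> 'L(Y1, Y)} {S : K -> 'L(U, Y)}.
Context {Sigma1 : system U Y1 k1} {Sigma2 : system Y1 Y k2}.
Context {H1 : rk_space S1} {H2 : rk_space S2} {H : rk_space S}.
Local Notation Sigma := (product_system Sigma2 Sigma1).

(** The theorem over the named canonical structure of R[i]. From left to right
the orthogonal sum of the two state spaces is transported along the canonical
model of the product; from right to left it is shown that only the zero state
of the product has vanishing output near 0. *)
Lemma factorization :
  schur_class k1 S1 -> schur_class k2 S2 -> is_product S S1 S2 ->
  coisometric Sigma1 -> observable Sigma1 -> realizes Sigma1 S1 ->
  coisometric Sigma2 -> observable Sigma2 -> realizes Sigma2 S2 ->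
  (coisometric Sigma /\ observable Sigma /\ realizes Sigma S) <->
  (product_decomposition H H1 H2 /\ multiplication_isometry S2 H H1).
Proof.
move=> [_ hol1 _] [_ hol2 _] [_ SE] co1 obs1 re1 co2 obs2 re2.
have hol : holomorphic_at S 0 := holomorphic_at_comp hol1 hol2 SE.
have [V1 [V1E V1iso V1onto]] := canonical_model H1 co1 obs1 re1 hol1.
have [V2 [V2E V2iso V2onto]] := canonical_model H2 co2 obs2 re2 hol2.
have co : coisometric Sigma by exact: product_coisometric.
have re : realizes Sigma S.
  have [r r0 rP] := @product_transfer_function _ _ _ _ _ _ Sigma2 Sigma1.
  have near_r : eq_near0 (transfer_function Sigma)
      (fun z u => transfer_function Sigma2 z (transfer_function Sigma1 z u)).
    by apply/eq_near0P; exists r => // z zr; apply/funext => u; exact: rP.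
  apply: (eq_near0_trans near_r); apply: (eq_near0_trans _ (eq_near0_sym SE)).
  by move: re1 re2; apply: filterS2 => z -> ->.
have outE x1 x2 : eq_near0 (state_output (Sigma := Sigma) (x1, x2))
    (fun z => Defs.mul_fun S2 (V1 x1) z + rk_eval (V2 x2) z).
  have [r r0 rP] := @product_state_output _ _ _ _ _ _ Sigma2 Sigma1.
  have near_r : eq_near0 (state_output (Sigma := Sigma) (x1, x2))
      (fun z => transfer_function Sigma2 z (state_output x1 z) + state_output x2 z).
    by apply/eq_near0P; exists r => // z zr; exact: rP.
  apply: (eq_near0_trans near_r).
  move: re2 (V1E x1) (V2E x2); rewrite /Defs.mul_fun; apply: filterS3 => z S2z -> ->.
  by rewrite S2z.
split=> [[_ [obs _]]|[[_ [iota [iotaE iota_iso]] [sM sN _ MN _]] [M [ME Miso]]]].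
  have [V [VE Viso Vonto]] := canonical_model H co obs re hol.
  have Vlin := isometry_onto_linear Viso Vonto.
  have VF x1 : eq_near0 (rk_eval (V (x1, 0))) (Defs.mul_fun S2 (V1 x1)).
    apply: eq_near0_trans (VE _) _; apply: eq_near0_trans (outE _ _) _.
    have V20 : V2 0 = 0.
      by apply: ip_injl => h; have [y <-] := V2onto h; rewrite V2iso !herm0l.
    have [r r0 dom] := holomorphy_domain_near0 hol2.
    apply/eq_near0P; exists r => // z zr.
    by rewrite V20 (rk_eval0 _ (dom z zr)) addr0.
  have VS x2 : eq_near0 (rk_eval (V (0, x2))) (rk_eval (V2 x2)).
    apply: eq_near0_trans (VE _) _; apply: eq_near0_trans (outE _ _) _.
    have V10 : V1 0 = 0.
      by apply: ip_injl => h; have [y <-] := V1onto h; rewrite V1iso !herm0l.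
    have [r r0 dom] := holomorphy_domain_near0 hol1.
    apply/eq_near0P; exists r => // z zr.
    by rewrite /Defs.mul_fun V10 (rk_eval0 _ (dom z zr)) cl_zero add0r.
  have /choice[W1 W1E] := V1onto; have /choice[W2 W2E] := V2onto.
  (* The canonical model of the product carries the two coordinate subspaces of
     its state space to S2 H(S1) and H(S2). *)
  have ME h : (exists h1 : H1, eq_near0 (rk_eval h) (Defs.mul_fun S2 h1)) <->
      exists x1, h = V (x1, 0).
    split=> [[h1 hE]|[x1 ->]]; last by exists (V1 x1); exact: VF.
    exists (W1 h1); apply: rk_inj; apply: (eq_near0_trans hE).
    by rewrite -{1}(W1E h1); apply: eq_near0_sym; exact: VF.
  have NE h : (exists h2 : H2, eq_near0 (rk_eval h) (rk_eval h2)) <->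
      exists x2, h = V (0, x2).
    split=> [[h2 hE]|[x2 ->]]; last by exists (V2 x2); exact: VS.
    exists (W2 h2); apply: rk_inj; apply: (eq_near0_trans hE).
    by rewrite -{1}(W2E h2); apply: eq_near0_sym; exact: VS.
  have V0 : V 0 = 0.
    by apply: ip_injl => h; have [y <-] := Vonto h; rewrite Viso !herm0l.
  split; last first.
    exists (fun h1 => V (W1 h1, 0)); split=> [h1|h h'].
      by rewrite -{2}(W1E h1); exact: VF.
    by rewrite Viso prod_ipE /= herm0l addr0 -V1iso !W1E.
  split.
  - by move=> h1; exists (V (W1 h1, 0)); rewrite -{2}(W1E h1); exact: VF.
  - exists (fun h2 => V (0, W2 h2)); split=> [h2|h h'].
      by rewrite -{2}(W2E h2); exact: VS.
    by rewrite Viso prod_ipE /= herm0l add0r -V2iso !W2E.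
  split.
  - apply/subspaceP; split=> [|a h h' /ME[x ->] /ME[y ->]].
      by apply/ME; exists 0.
    apply/ME; exists (a *: x + y); rewrite -Vlin; congr (V _).
    by congr (_, _) => /=; rewrite scaler0 addr0.
  - apply/subspaceP; split=> [|a h h' /NE[x ->] /NE[y ->]].
      by apply/NE; exists 0.
    apply/NE; exists (a *: x + y); rewrite -Vlin; congr (V _).
    by congr (_, _) => /=; rewrite scaler0 addr0.
  - move=> h; have [[x1 x2] <-] := Vonto h; exists (V (x1, 0)), (V (0, x2)).
    split; [by apply/ME; exists x1|by apply/NE; exists x2|].
    rewrite -[V (x1, 0)]scale1r -Vlin scale1r; congr (V _).
    by congr (_, _) => /=; rewrite ?addr0 ?add0r.
  - move=> h /ME[x1 ->] /NE[x2 E].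
    by have [-> _] := isometry_inj Viso E.
  - move=> h h' /ME[x1 ->] /NE[x2 ->].
    by rewrite Viso prod_ipE /= herm0l herm0r addr0.
split=> //; split=> //; apply/observableP => -[x1 x2] x0.
(* The function attached to (x1, x2), which vanishes near 0, is the sum of an
   element of S2 H(S1) and an element of H(S2). *)
have sum0 : M (V1 x1) + iota (V2 x2) = 0.
  have [r r0 dom] := holomorphy_domain_near0 hol.
  apply: rk_inj; move/eq_near0_sym: (outE x1 x2) => E.
  have dom0 : eq_near0 (fun z => rk_eval (M (V1 x1) + iota (V2 x2)) z)
     (fun z => rk_eval (M (V1 x1)) z + rk_eval (iota (V2 x2)) z).
    apply/eq_near0P; exists r => // z zr.
    have := rk_linear (dom z zr) 1 (M (V1 x1)) (iota (V2 x2)).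
    by rewrite !scale1r.
  have rk0 : eq_near0 (rk_eval (0 : H)) (fun=> 0).
    by apply/eq_near0P; exists r => // z zr; exact: rk_eval0 (dom z zr).
  apply: (eq_near0_trans dom0); apply: (eq_near0_trans _ (eq_near0_sym rk0)).
  apply: (eq_near0_trans _ x0); apply: (eq_near0_trans _ E).
  by move: (ME (V1 x1)) (iotaE (V2 x2)); apply: filterS2 => z -> ->.
have M0 : M (V1 x1) = 0.
  apply: MN; first by exists (V1 x1); exact: ME.
  have -> : M (V1 x1) = (-1) *: iota (V2 x2).
    by apply/eqP; rewrite scaleN1r -addr_eq0 sum0.
  by apply: subspaceZ => //; exists (V2 x2); exact: iotaE.
have iota0 : iota (V2 x2) = 0 by move: sum0; rewrite M0 add0r.
have x10 : x1 = 0.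
  apply: ip_injl => y; rewrite -V1iso -Miso M0 !herm0l //.
have x20 : x2 = 0.
  apply: ip_injl => y; rewrite -V2iso -iota_iso iota0 !herm0l //.
by rewrite x10 x20.
Qed.

End Factorization.

Theorem theorem3p6 (R : realType) (U Y1 Y : hilbertType R[i]) (k1 k2 : nat)
    (S1 : R[i] -> 'L(U, Y1)) (S2 : R[i] -> 'L(Y1, Y)) (S : R[i] -> 'L(U, Y))
    (Sigma1 : system U Y1 k1) (Sigma2 : system Y1 Y k2)
    (H1 : rk_space S1) (H2 : rk_space S2) (H : rk_space S) :
  schur_class k1 S1 -> schur_class k2 S2 -> is_product S S1 S2 ->
  coisometric Sigma1 -> observable Sigma1 -> realizes Sigma1 S1 ->
  coisometric Sigma2 -> observable Sigma2 -> realizes Sigma2 S2 ->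
  (coisometric (product_system Sigma2 Sigma1) /\
   observable (product_system Sigma2 Sigma1) /\
   realizes (product_system Sigma2 Sigma1) S) <->
  (product_decomposition H H1 H2 /\ multiplication_isometry S2 H H1).
Proof. exact: factorization. Qed.
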